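(* Let $\mathcal G$, $f_i^0,f_i^1,f_i^2$ ($i\in\{1,\dots,n\}$), the optimization problem (P), the algorithm (A) with parameters $\alpha,\gamma$ satisfying $0<\alpha<\frac{1}{\lambda_{\max}(L_n)}$ and $0<\gamma<1-\alpha\lambda_{\max}(L_n)$, and the function $V$ be as defined in the context, and suppose that Assumptions 1--4 listed in the context hold. Let $(x^*,z^*,v^* )\in\mathbb R^{nq}\times\mathbb R^{nq}\times\mathbb R^{nq}$ be an equilibrium of (A), and let $V$ be the function associated with this equilibrium. Then: (i) $V(x,z,v)$ is positive definite (with respect to the point $(x^*,z^*,v^* )$) and radially unbounded, and $V(x,z,v)=0$ if and only if $(x,z,v)=(x^*,z^*,v^* )$. (ii) Every equilibrium $(x^*,z^*,v^* )$ of (A) is Lyapunov stable, and every trajectory $(x(t),z(t),v(t))$, $t\ge 0$, of (A) is bounded. (iii) Moreover, every trajectory $(x(t),z(t),v(t))$ of (A) converges as $t\to\infty$, and $\lim_{t\to\infty}x(t)$ is a solution to problem (P).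
   Context: **Graph.** $\mathcal G$ is a weighted undirected graph with node set $\{1,\dots,n\}$ and weighted adjacency matrix $\mathcal A=[a_{i,j}]\in\mathbb R^{n\times n}$, where $a_{i,j}=a_{j,i}>0$ if $(j,i)$ is an edge and $a_{i,j}=0$ otherwise (edges join distinct nodes). $\mathcal N_i$ is the set of neighbours of $i$. The Laplacian is $L_n=D-\mathcal A$ with $D$ diagonal, $D_{i,i}=\sum_{j=1}^n a_{i,j}$; $\lambda_{\max}(L_n)$ is its largest eigenvalue. Put $L_{nq}=L_n\otimes I_q\in\mathbb R^{nq\times nq}$ (Kronecker product with the $q\times q$ identity). **Problem (P).** For each $i\in\{1,\dots,n\}$ there are functions $f_i^0,f_i^1,f_i^2:\mathbb R^q\to\mathbb R$. With $x=[x_1^T,\dots,x_n^T]^T\in\mathbb R^{nq}$, $x_i\in\mathbb R^q$, problem (P) is $$\min_{x\in\mathbb R^{nq}}\ \sum_{i=1}^n\big(f_i^0(x_i)+f_i^1(x_i)+f_i^2(x_i)\big)\quad\text{subject to } L_{nq}x=\mathbf 0_{nq}.$$ **Assumptions.** 1. Each $f_i^0$ is twice continuously differentiable and strongly convex: there is a constant $c$ such that for every $i$ and all $\vartheta_1\neq\vartheta_2$ in $\mathbb R^q$, $(\nabla f_i^0(\vartheta_1)-\nabla f_i^0(\vartheta_2))^T(\vartheta_1-\vartheta_2)\ge c\|\vartheta_1-\vartheta_2\|^2$; moreover $c>1$. 2. Each $f_i^1$ and $f_i^2$ is a (possibly nonsmooth) lower semi-continuous closed proper convex function and is proximable (its proximal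 operator is computationally easy to evaluate, having a closed or semi-closed form). 3. The weighted graph $\mathcal G$ is connected and undirected. 4. Problem (P) has at least one finite solution. **Proximal operator.** For a lower semi-continuous convex function $f$ on $\mathbb R^r$ and $\eta\in\mathbb R^r$, $\mathrm{prox}_f[\eta]=\arg\min_{\delta}\{f(\delta)+\tfrac12\|\delta-\eta\|^2\}$, with $\|\cdot\|$ the Euclidean norm. **Algorithm (A).** It is the system of ordinary differential equations for $t\ge0$, $i\in\{1,\dots,n\}$, $x_i,z_i,v_i\in\mathbb R^q$: $$\begin{aligned} \dot x_i&=\mathrm{prox}_{f_i^1}\Big[x_i-\nabla f_i^0(x_i)-\alpha\sum_{j\in\mathcal N_i}a_{i,j}(v_i-v_j)-\alpha\sum_{j\in\mathcal N_i}a_{i,j}(x_i-x_j)+\gamma z_i\Big]-x_i,\\ \dot z_i&=\mathrm{prox}_{f_i^2}[x_i-\gamma z_i]-x_i,\\ \dot v_i&=\alpha\sum_{j\in\mathcal N_i}a_{i,j}(x_i-x_j). \end{aligned}$$ Writing $x=[x_1^T,\dots,x_n^T]^T$ and similarly $z,v$, and letting $\mathrm{PROX}_{F^j}[\xi]=[(\mathrm{prox}_{f_1^j}[\xi_1])^T,\dots,(\mathrm{prox}_{f_n^j}[\xi_n])^T]^T$ for $j\in\{1,2\}$ and $\nabla F^0(x)=[(\nabla f_1^0(x_1))^T,\dots,(\nabla f_n^0(x_n))^T]^T$, the equivalent compact form is $$\dot x=\mathrm{PROX}_{F^1}[x-\nabla F^0(x)-\alpha L_{nq}v-\alpha L_{nq}x+\gamma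 z]-x,\quad \dot z=\mathrm{PROX}_{F^2}[x-\gamma z]-x,\quad \dot v=\alpha L_{nq}x.$$ An equilibrium is a point $(x^*,z^*,v^* )$ at which all right-hand sides vanish. **Function $V$.** Given an equilibrium $(x^*,z^*,v^* )$ of (A), let $F^0(x)=[f_1^0(x_1),\dots,f_n^0(x_n)]^T$, $\mathbf 1_n$ the all-ones vector in $\mathbb R^n$, and $V(x,z,v)=V_1(x,z,v)+V_2(x)+V_3(x,v)$, where $$\begin{aligned} V_1&=\tfrac12\|x-x^*\|^2+\tfrac12\gamma\|z-z^*\|^2-\gamma(x-x^* )^T(z-z^* )+\tfrac12\|v-v^*\|^2,\\ V_2&=\mathbf 1_n^T(F^0(x)-F^0(x^* ))-(x-x^* )^T\nabla F^0(x^* )+\tfrac12\alpha x^TL_{nq}x,\\ V_3&=\alpha x^TL_{nq}(v-v^* ). \end{aligned}$$ ''Positive definite with respect to $(x^*,z^*,v^* )$'' means $V(x^*,z^*,v^* )=0$ and $V(x,z,v)>0$ at every other point; ''radially unbounded'' means $V(x,z,v)\to\infty$ as $\|(x,z,v)\|\to\infty$. Lyapunov stability is in the usual sense for the autonomous system (A). *)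

(* Defs.v *)
From mathcomp Require Import all_boot all_order all_algebra.
From mathcomp Require Import all_classical all_reals all_analysis.
From mathcomp.real_closed Require Export mxtens.

Set Implicit Arguments.
Unset Strict Implicit.
Unset Printing Implicit Defensive.

Import Order.TTheory GRing.Theory Num.Theory.
Import numFieldNormedType.Exports.

Local Open Scope classical_set_scope.
Local Open Scope ring_scope.

(* The library norm `|u| on matrices is the max norm, so the Euclidean one is
   introduced separately. *)
Definition dotp (R : realType) (r : nat) (u w : 'cV[R]_r) : R :=
  (u^T *m w) 0 0.

Definition enorm (R : realType) (r : nat) (u : 'cV[R]_r) : R :=
  Num.sqrt (dotp u u).

(* A vector of R^{nq} is indexed so that x = [x_1^T, ..., x_n^T]^T agrees with
   the Kronecker product *t. *)
Definition block (R : realType) (n q : nat) (x : 'cV[R]_(n * q)) (i : 'I_n) :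
    'cV[R]_q :=
  \col_k x (mxtens_index (i, k)) 0.

Definition stack (R : realType) (n q : nat) (u : 'I_n -> 'cV[R]_q) :
    'cV[R]_(n * q) :=
  \col_k u (mxtens_unindex k).1 (mxtens_unindex k).2 0.

(** * Graphs *)

Definition weighted_graph (R : realType) (n : nat) (e : rel 'I_n)
    (A : 'M[R]_n) : Prop :=
  [/\ symmetric e, irreflexive e,
      forall i j, A i j = A j i,
      forall i j, e j i -> 0 < A i j &
      forall i j, ~~ e j i -> A i j = 0].

Definition connected_graph (n : nat) (e : rel 'I_n) : Prop :=
  forall i j, connect e i j.

Definition laplacian (R : realType) (n : nat) (A : 'M[R]_n) : 'M[R]_n :=
  diag_mx (\row_i \sum_j A i j) - A.

Definition laplacian_nq (R : realType) (n q : nat) (A : 'M[R]_n) :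
    'M[R]_(n * q) :=
  laplacian A *t (1%:M : 'M[R]_q).

(* The set of eigenvalues is finite, so for a nonempty real spectrum (as for a
   symmetric matrix of positive size) this sup is a maximum. *)
Definition lambda_max (R : realType) (n : nat) (M : 'M[R]_n) : R :=
  sup [set l | eigenvalue M l].

(** * Function classes *)

Definition partial (R : realType) (q : nat) (i : 'I_q) (f : 'cV[R]_q -> R) :
    'cV[R]_q -> R :=
  'D_(delta_mx i 0) f.

Definition gradient (R : realType) (q : nat) (f : 'cV[R]_q -> R)
    (x : 'cV[R]_q) : 'cV[R]_q :=
  \col_i partial i f x.

Definition twice_continuously_differentiable (R : realType) (q : nat)
    (f : 'cV[R]_q -> R) : Prop :=
  [/\ forall x, differentiable f x,
      forall x, differentiable (gradient f) x &
      forall i j, continuous (partial j (partial i f))].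

Definition strongly_convex (R : realType) (q : nat) (c : R)
    (f : 'cV[R]_q -> R) : Prop :=
  forall a b : 'cV[R]_q, a <> b ->
    c * enorm (a - b) ^+ 2 <= dotp (gradient f a - gradient f b) (a - b).

(* The nonsmooth terms are extended-real-valued, the setting in which "closed"
   and "proper" are meaningful; a real-valued g is the case f = EFin \o g. *)
Definition proper_function (R : realType) (q : nat) (f : 'cV[R]_q -> \bar R) :
    Prop :=
  (forall x, f x <> -oo%E) /\ (exists x, f x \is a fin_num).

Definition closed_function (R : realType) (q : nat) (f : 'cV[R]_q -> \bar R) :
    Prop :=
  closed [set p : 'cV[R]_q * R | (f p.1 <= p.2%:E)%E].

Definition convex_ereal_function (R : realType) (q : nat)
    (f : 'cV[R]_q -> \bar R) : Prop :=
  forall (x y : 'cV[R]_q) (t : R), 0 <= t -> t <= 1 ->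
    (f (t *: x + (1 - t) *: y)%R <= t%:E * f x + (1 - t)%:E * f y)%E.

Definition lsc_closed_proper_convex (R : realType) (q : nat)
    (f : 'cV[R]_q -> \bar R) : Prop :=
  [/\ lower_semicontinuous f, closed_function f, proper_function f &
      convex_ereal_function f].

(* The argmin is a singleton for a proper lower semi-continuous convex f; the
   value 0 is only a default for an empty argmin. *)
Definition prox (R : realType) (r : nat) (f : 'cV[R]_r -> \bar R)
    (eta : 'cV[R]_r) : 'cV[R]_r :=
  xget 0 [set d : 'cV[R]_r | forall d' : 'cV[R]_r,
    (f d + (2^-1 * enorm (d - eta) ^+ 2)%:E
     <= f d' + (2^-1 * enorm (d' - eta) ^+ 2)%:E)%E].

(** * The optimization problem *)

Definition objective (R : realType) (n q : nat) (f0 : 'I_n -> 'cV[R]_q -> R)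
    (f1 f2 : 'I_n -> 'cV[R]_q -> \bar R) (x : 'cV[R]_(n * q)) : \bar R :=
  (\sum_(i < n)
     ((f0 i (block x i))%:E + f1 i (block x i) + f2 i (block x i)))%E.

Definition solution (R : realType) (n q : nat) (A : 'M[R]_n)
    (f0 : 'I_n -> 'cV[R]_q -> R) (f1 f2 : 'I_n -> 'cV[R]_q -> \bar R)
    (x : 'cV[R]_(n * q)) : Prop :=
  [/\ laplacian_nq q A *m x = 0,
      objective f0 f1 f2 x \is a fin_num &
      forall y : 'cV[R]_(n * q), laplacian_nq q A *m y = 0 ->
        (objective f0 f1 f2 x <= objective f0 f1 f2 y)%E].

(** * Autonomous differential equations on [0, +oo[ *)

(* The difference quotient is taken over times t' >= 0 with t' <> t: at t = 0
   this is the right derivative, at t > 0 the usual derivative. *)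
Definition trajectory (R : realType) (S : normedModType R) (F : S -> S)
    (X : R -> S) : Prop :=
  forall t : R, 0 <= t ->
    (t' - t)^-1 *: (X t' - X t) @[t' --> within [set t' | 0 <= t'] t^']
      --> F (X t).

Definition equilibrium (R : realType) (S : normedModType R) (F : S -> S)
    (s : S) : Prop :=
  F s = 0.

Definition lyapunov_stable (R : realType) (S : normedModType R) (F : S -> S)
    (s : S) : Prop :=
  forall eps : R, 0 < eps -> exists2 delta : R, 0 < delta &
    forall X : R -> S, trajectory F X -> `|X 0 - s| < delta ->
      forall t : R, 0 <= t -> `|X t - s| < eps.

Definition positive_definite_at (R : realType) (S : normedModType R)
    (V : S -> R) (s : S) : Prop :=
  V s = 0 /\ forall s' : S, s' <> s -> 0 < V s'.

Definition radially_unbounded (R : realType) (S : normedModType R)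
    (V : S -> R) : Prop :=
  forall M : R, exists r : R, forall s : S, r < `|s| -> M < V s.

(** * The algorithm and its Lyapunov function *)

(* States are triples (x, z, v). *)
Definition state (R : realType) (n q : nat) : normedModType R :=
  ('cV[R]_(n * q) * 'cV[R]_(n * q) * 'cV[R]_(n * q))%type.

Definition coupling (R : realType) (n q : nat) (e : rel 'I_n) (A : 'M[R]_n)
    (y : 'cV[R]_(n * q)) (i : 'I_n) : 'cV[R]_q :=
  \sum_(j < n | e j i) A i j *: (block y i - block y j).

Definition algorithm (R : realType) (n q : nat) (e : rel 'I_n) (A : 'M[R]_n)
    (f0 : 'I_n -> 'cV[R]_q -> R) (f1 f2 : 'I_n -> 'cV[R]_q -> \bar R)
    (alpha gamma : R) (s : state R n q) : state R n q :=
  let: (x, z, v) := s in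
  (stack (fun i =>
     prox (f1 i) (block x i - gradient (f0 i) (block x i)
                  - alpha *: coupling e A v i - alpha *: coupling e A x i
                  + gamma *: block z i) - block x i),
   stack (fun i => prox (f2 i) (block x i - gamma *: block z i) - block x i),
   stack (fun i => alpha *: coupling e A x i)).

Definition F0_vec (R : realType) (n q : nat) (f0 : 'I_n -> 'cV[R]_q -> R)
    (x : 'cV[R]_(n * q)) : 'cV[R]_n :=
  \col_i f0 i (block x i).

Definition gradF0 (R : realType) (n q : nat) (f0 : 'I_n -> 'cV[R]_q -> R)
    (x : 'cV[R]_(n * q)) : 'cV[R]_(n * q) :=
  stack (fun i => gradient (f0 i) (block x i)).

Definition V1 (R : realType) (n q : nat) (gamma : R)
    (star s : state R n q) : R :=
  let: (xs, zs, vs) := star in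
  let: (x, z, v) := s in
  2^-1 * enorm (x - xs) ^+ 2 + 2^-1 * gamma * enorm (z - zs) ^+ 2
  - gamma * dotp (x - xs) (z - zs) + 2^-1 * enorm (v - vs) ^+ 2.

Definition V2 (R : realType) (n q : nat) (A : 'M[R]_n)
    (f0 : 'I_n -> 'cV[R]_q -> R) (alpha : R) (star s : state R n q) : R :=
  let: (xs, _, _) := star in
  let: (x, _, _) := s in
  dotp (const_mx 1) (F0_vec f0 x - F0_vec f0 xs)
  - dotp (x - xs) (gradF0 f0 xs)
  + 2^-1 * alpha * dotp x (laplacian_nq q A *m x).

Definition V3 (R : realType) (n q : nat) (A : 'M[R]_n) (alpha : R)
    (star s : state R n q) : R :=
  let: (_, _, vs) := star in
  let: (x, _, v) := s in
  alpha * dotp x (laplacian_nq q A *m (v - vs)).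

Definition lyapunov_V (R : realType) (n q : nat) (A : 'M[R]_n)
    (f0 : 'I_n -> 'cV[R]_q -> R) (alpha gamma : R)
    (star s : state R n q) : R :=
  V1 gamma star s + V2 A f0 alpha star s + V3 A alpha star s.

(* Main.v *)
(* Write B = alpha L_nq, so that 0 <= B <= (1 - gamma) I by the bound on alpha
   and gamma.  Completing the squares and using strong convexity of f^0,
   V dominates a multiple of the squared distance to the equilibrium.  Along a
   trajectory, the optimality conditions of the two proximal points
   p = x + dx and w = x + dz and of the equilibrium, combined by monotonicity of
   the subdifferentials, bound dV/dt by
     - |dx|^2 - k (|dz|^2 + |x - xs|^2),   k = (1 - gamma) / 2 ,
   which vanishes only at equilibria.  Hence every equilibrium is stable and
   every trajectory is bounded; a cluster point of a trajectory is an equilibrium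
   by LaSalle's argument, and its own stability forces convergence to it.
   Finally an equilibrium satisfies the optimality conditions of (P). *)
Require Import Defs.
From mathcomp Require Import all_boot all_order all_algebra.
From mathcomp Require Import all_classical all_reals all_analysis.
From mathcomp Require Import ring lra.

Set Implicit Arguments.
Unset Strict Implicit.
Unset Printing Implicit Defensive.

Import Order.TTheory GRing.Theory Num.Theory.
Import numFieldNormedType.Exports.

Local Open Scope classical_set_scope.
Local Open Scope ring_scope.

(** Why [V] has this form: when both proximal inequalities are added to dV/dt, every product
    containing [z - zs] or [B (v - vs)] cancels. The only cross term left is that of [x - xs] with
    [dz], with coefficient [1 + gamma]. Young's inequality charges it as [(1 + gamma) / 2] to each
    of [|x - xs|^2] and [|dz|^2]. One full [|dz|^2] comes from the second proximal inequality and
    one full [|x - xs|^2] from strong convexity with modulus at least 1; what remains is [k]. The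
    term [|B x|^2] produced by V3 is paid by [x.Bx], which is where [B <= I] enters. Equilibria are
    in general not isolated, since adding a consensus vector to [vs] gives another one. Hence the
    Lyapunov function of one equilibrium cannot identify the limit, and a cluster point is given its
    own. *)

(** * Inner products and symmetric forms *)

Section Dotp.
Variables (R : realType) (r : nat).
Implicit Types (u w y : 'cV[R]_r) (a : R).

Lemma dotpE u w : dotp u w = \sum_k u k 0 * w k 0.
Proof. by rewrite /dotp mxE; apply: eq_bigr => k _; rewrite mxE. Qed.

Lemma dotpC u w : dotp u w = dotp w u.
Proof. by rewrite !dotpE; apply: eq_bigr => k _; rewrite mulrC. Qed.

Lemma dotpDl u w y : dotp (u + w) y = dotp u y + dotp w y.
Proof. by rewrite /dotp linearD mulmxDl mxE. Qed.

Lemma dotpDr u w y : dotp y (u + w) = dotp y u + dotp y w.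
Proof. by rewrite dotpC dotpDl !(dotpC y). Qed.

Lemma dotpZl a u w : dotp (a *: u) w = a * dotp u w.
Proof. by rewrite /dotp linearZ -scalemxAl mxE. Qed.

Lemma dotpZr a u w : dotp u (a *: w) = a * dotp u w.
Proof. by rewrite dotpC dotpZl dotpC. Qed.

Lemma dotpNl u w : dotp (- u) w = - dotp u w.
Proof. by rewrite -scaleN1r dotpZl mulN1r. Qed.

Lemma dotpNr u w : dotp u (- w) = - dotp u w.
Proof. by rewrite dotpC dotpNl dotpC. Qed.

Lemma dotp0l u : dotp 0 u = 0.
Proof. by rewrite -(scale0r u) dotpZl mul0r. Qed.

Lemma dotp0r u : dotp u 0 = 0.
Proof. by rewrite dotpC dotp0l. Qed.

Definition dotp_bilin :=
  (dotpDl, dotpDr, dotpNl, dotpNr, dotpZl, dotpZr).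

Lemma dotp_ge0 u : 0 <= dotp u u.
Proof. by rewrite dotpE sumr_ge0// => k _; rewrite -expr2 sqr_ge0. Qed.

Lemma dotp_coord_le u k : u k 0 ^+ 2 <= dotp u u.
Proof.
rewrite dotpE (bigD1 k)//= expr2 lerDl sumr_ge0// => j _.
by rewrite -expr2 sqr_ge0.
Qed.

Lemma dotp_eq0 u : dotp u u = 0 -> u = 0.
Proof.
move=> u0; apply/colP => k; rewrite mxE; apply/eqP.
by rewrite -sqrf_eq0 eq_le sqr_ge0 andbT -u0 dotp_coord_le.
Qed.

Lemma dotp_gt0 u : u != 0 -> 0 < dotp u u.
Proof.
move=> u0; rewrite lt_def dotp_ge0 andbT.
by apply: contra_neq u0; exact: dotp_eq0.
Qed.

Lemma enorm_sqr u : enorm u ^+ 2 = dotp u u.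
Proof. by rewrite /enorm sqr_sqrtr// dotp_ge0. Qed.

Lemma normr_cV_le u a : 0 <= a -> (`|u| <= a) = [forall k, `|u k 0| <= a].
Proof.
move=> a0; rewrite {1}/Num.Def.normr/= mx_normrE.
apply/bigmax_leP/forallP => [[_ H] k|H].
  exact: (H (k, 0)).
by split=> // -[k j] _ /=; rewrite ord1.
Qed.

Lemma normr_coord_le u k : `|u k 0| <= `|u|.
Proof. by move: k; apply/forallP; rewrite -normr_cV_le. Qed.

(** Stability and convergence refer to the max norm, the energy estimates to the inner product; this
    comparison passes from the second to the first. *)
Lemma sqr_normr_le_dotp u : `|u| ^+ 2 <= dotp u u.
Proof.
rewrite -[leLHS]ger0_norm ?sqr_ge0//.
have d0 := dotp_ge0 u.
rewrite -(sqr_sqrtr d0) ger0_norm ?sqr_ge0// ler_pXn2r ?nnegrE ?sqrtr_ge0//.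
rewrite normr_cV_le ?sqrtr_ge0//; apply/forallP => k.
by rewrite -sqrtr_sqr ler_wsqrtr// dotp_coord_le.
Qed.

(** Both signs follow from [|a u + w|^2 >= 0] and [|a u - w|^2 >= 0], divided by [a]. *)
Lemma dotp_young u w (a : R) : 0 < a ->
  `|2 * dotp u w| <= a * dotp u u + a^-1 * dotp w w.
Proof.
move=> a0; have := dotp_ge0 (a *: u + w); have := dotp_ge0 (a *: u - w).
rewrite !dotp_bilin (dotpC w u) => H1 H2.
rewrite -(ler_pM2l a0) mulrDr mulVKf ?gt_eqF// -{1}(gtr0_norm a0) -normrM.
by rewrite ler_norml; apply/andP; split; lra.
Qed.

Lemma dotp_mul_sym (L : 'M[R]_r) u w : L^T = L ->
  dotp u (L *m w) = dotp (L *m u) w.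
Proof. by move=> LT; rewrite /dotp trmx_mul LT mulmxA. Qed.

Lemma sum_delta u : u = \sum_k u k 0 *: delta_mx k 0.
Proof.
rewrite [LHS]matrix_sum_delta; apply: eq_bigr => k _.
by rewrite big_ord1.
Qed.

End Dotp.

(** * Continuity and compactness in spaces of matrices *)

Section Topology.
Variable R : realType.

Lemma cvg_mx (T : Type) (F : set_system T) {FF : Filter F} m n
    (f : T -> 'M[R]_(m, n)) (l : 'M[R]_(m, n)) :
  (forall i j, f x i j @[x --> F] --> l i j) -> f x @[x --> F] --> l.
Proof.
move=> H; apply/cvgrPdist_le => /= e e0.
near=> x; rewrite /Num.Def.normr/= mx_normrE (bigmax_le _ (ltW e0))//= => i _.
rewrite !mxE/=; move: i; near: x; apply: filter_forall => /= i.
exact: ((cvgrPdist_le _ _).1 (H i.1 i.2)).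
Unshelve. all: by end_near. Qed.

Lemma mx_continuous (T : topologicalType) m n (f : T -> 'M[R]_(m, n)) :
  (forall i j, continuous (fun x => f x i j)) -> continuous f.
Proof. by move=> H x; apply: cvg_mx => i j; exact: H. Qed.

Lemma continuousT_comp (T U V : topologicalType) (f : T -> U) (g : U -> V) :
  continuous f -> continuous g -> continuous (fun x => g (f x)).
Proof. by move=> cf cg x; exact: (cvg_comp _ _ (cf x) (cg (f x))). Qed.

(** Transposition is an isometry onto row vectors, where Heine-Borel is [bounded_closed_compact]. *)
Lemma cV_bounded_closed_compact r (A : set 'cV[R]_r) :
  bounded_set A -> closed A -> compact A.
Proof.
have ctr m n : continuous (@trmx R m n).
  apply: mx_continuous => i j; under eq_fun do rewrite mxE.
  exact: coord_continuous.
have ntr (u : 'rV[R]_r) : `|u^T| = `|u|.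
  rewrite /Num.Def.normr/= !mx_normrE; apply/eqP; rewrite eq_le.
  apply/andP; split; apply: bigmax_le => [|ij _].
  - exact: bigmax_ge_id.
  - by rewrite mxE; exact: (le_bigmax _ _ (ij.2, ij.1)).
  - exact: bigmax_ge_id.
  - by have := le_bigmax 0 (fun ij => `|u^T ij.1 ij.2|) (ij.2, ij.1); rewrite mxE.
move=> bA cA; pose B := [set u : 'rV[R]_r | A u^T].
have -> : A = trmx @` B.
  rewrite eqEsubset; split=> [u Au|_ [u Bu <-]//].
  by exists u^T; rewrite /B/= trmxK.
apply: continuous_compact; first exact/continuous_subspaceT/ctr.
apply: bounded_closed_compact; last by apply: closed_comp cA => u _; exact: ctr.
case: bA => M [Mr HM]; exists M; split=> // x Mx u Bu.
apply: le_trans (HM _ Mx _ Bu).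
by have /esym/eqP := ntr u; rewrite eq_le => /andP[].
Qed.

Lemma continuous_sumr (T : topologicalType) (V : normedModType R) (I : Type)
    (s : seq I) (F : I -> T -> V) :
  (forall i, continuous (F i)) -> continuous (fun x => \sum_(i <- s) F i x).
Proof.
by move=> cF; apply: continuous_big => [|i _]; [exact: add_continuous|exact: cF].
Qed.

Lemma continuousMl (T : topologicalType) (a : R) (f : T -> R) :
  continuous f -> continuous (fun x => a * f x).
Proof. by move=> cf x; apply: cvgM; [exact: cvg_cst|exact: cf]. Qed.

Lemma continuous_dotp (T : topologicalType) r (f g : T -> 'cV[R]_r) :
  continuous f -> continuous g -> continuous (fun x => dotp (f x) (g x)).
Proof.
move=> cf cg; under eq_fun do rewrite dotpE.
apply: continuous_sumr => k x; apply: cvgM.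
  exact: (cvg_comp _ _ (cf x) (@coord_continuous _ _ _ k 0 (f x))).
exact: (cvg_comp _ _ (cg x) (@coord_continuous _ _ _ k 0 (g x))).
Qed.

Lemma continuous_mulmx m n p (M : 'M[R]_(m, n)) :
  continuous (fun x : 'M[R]_(n, p) => M *m x).
Proof.
apply: mx_continuous => i j; under eq_fun do rewrite mxE.
apply: continuous_sumr => k; apply: continuousMl.
exact: coord_continuous.
Qed.

Lemma continuous_addv (T : topologicalType) (V : normedModType R) (f g : T -> V) :
  continuous f -> continuous g -> continuous (fun t => f t + g t).
Proof. by move=> cf cg t; apply: cvgD; [exact: cf|exact: cg]. Qed.

Lemma continuous_oppv (T : topologicalType) (V : normedModType R) (f : T -> V) :
  continuous f -> continuous (fun t => - f t).
Proof. by move=> cf t; apply: cvgN; exact: cf. Qed.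

Lemma continuous_scalev (T : topologicalType) (V : normedModType R) (a : R)
  (f : T -> V) : continuous f -> continuous (fun t => a *: f t).
Proof. by move=> cf t; apply: cvgZ; [exact: cvg_cst|exact: cf]. Qed.

Lemma continuous_pair (T U V : topologicalType) (f : T -> U) (g : T -> V) :
  continuous f -> continuous g -> continuous (fun t => (f t, g t)).
Proof. by move=> cf cg t; apply: cvg_pair; [exact: cf|exact: cg]. Qed.

Lemma continuous_cst (T U : topologicalType) (a : U) : continuous (fun _ : T => a).
Proof. by move=> t; exact: cvg_cst. Qed.

Lemma continuousBr (V : normedModType R) (a : V) :
  continuous (fun x => x - a).
Proof. by move=> x; apply: cvgB; [exact: cvg_id|exact: cvg_cst]. Qed.

Lemma continuousBl (V : normedModType R) (a : V) :
  continuous (fun x => a - x).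
Proof. by move=> x; apply: cvgB; [exact: cvg_cst|exact: cvg_id]. Qed.

Lemma continuous_dist (V : normedModType R) (a : V) :
  continuous (fun x => `|x - a|).
Proof. by move=> x; apply: cvg_norm; exact: continuousBr. Qed.

Lemma near_gt_continuous (T : topologicalType) (g : T -> R)
    (x : T) (a : R) :
  continuous g -> a < g x -> \forall y \near x, a < g y.
Proof. by move=> cg ax; apply: (cvgr_gt (g x)); first exact: cg. Qed.

Lemma cvg_sqr_dist (T : topologicalType) (V : normedModType R)
    (h : T -> V) (x : T) (N : T -> R) :
  continuous N -> N x = 0 -> (forall y, `|h x - h y| ^+ 2 <= N y) ->
  h y @[y --> x] --> h x.
Proof.
move=> cN N0 hN; apply/cvgrPdist_le => /= ep ep0; near=> y.
rewrite -(@ler_pXn2r _ 2%N) ?nnegrE ?(ltW ep0)//.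
apply: le_trans (hN _) _.
near: y; apply: (cvgr_le (N x)); first exact: cN.
by rewrite N0 exprn_gt0.
Unshelve. all: by end_near. Qed.

End Topology.

(** * Positive semidefinite forms and the Rayleigh quotient *)

Section SymmetricForms.
Variables (R : realType) (r : nat).
Implicit Types (L : 'M[R]_r) (u w : 'cV[R]_r).

(* [0 <= (u + t w).L(u + t w) = 2 t (Lu).w + t^2 w.Lw] for every t. *)
Lemma psd_kernel L u : L^T = L -> (forall w, 0 <= dotp w (L *m w)) ->
  dotp u (L *m u) = 0 -> L *m u = 0.
Proof.
move=> LT L0 u0; apply: dotp_eq0; set w := L *m u.
set b := dotp w (L *m w).
have H t : 0 <= 2 * t * dotp w w + t ^+ 2 * b.
  have := L0 (u + t *: w).
  rewrite mulmxDr -scalemxAr !dotp_bilin u0 -/b [dotp u _]dotp_mul_sym// -/w.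
  by move=> /le_trans; apply; rewrite le_eqVlt; apply/orP; left; apply/eqP; ring.
have := dotp_ge0 w; have b0 : 0 <= b by exact: L0.
set d := dotp w w in H *; move=> d0; apply/eqP; rewrite eq_le d0 andbT leNgt.
apply/negP => dgt.
(* The quadratic in [t] is least at [- d / b]; the denominator [b + 1] also covers [b = 0] and still
   makes the value negative. *)
have := H (- d / (b + 1)).
have b1 : 0 < b + 1 by lra.
have -> : 2 * (- d / (b + 1)) * d + (- d / (b + 1)) ^+ 2 * b =
  - (d ^+ 2 * (b + 2) / (b + 1) ^+ 2) by field; rewrite gt_eqF.
rewrite oppr_ge0 leNgt => /negP; apply.
by rewrite divr_gt0 ?exprn_gt0// mulr_gt0 ?exprn_gt0//; lra.
Qed.

(* A maximizer of the Rayleigh quotient lies in the kernel of the positive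
   semidefinite matrix [mu - L], where [mu] is the maximum. *)
Lemma rayleigh_le_lambda_max L u : L^T = L ->
  dotp u (L *m u) <= lambda_max L * dotp u u.
Proof.
move=> LT; have [->|u0] := eqVneq u 0; first by rewrite !dotp0l mulr0.
pose S := [set w : 'cV[R]_r | dotp w w = 1].
have cdot : continuous (fun w : 'cV[R]_r => dotp w w).
  by apply: continuous_dotp => x; exact: cvg_id.
have nz w : w != 0 -> S ((Num.sqrt (dotp w w))^-1 *: w).
  move=> w0; rewrite /S/= !dotp_bilin mulrA -expr2 exprVn sqr_sqrtr ?dotp_ge0//.
  by rewrite mulVf// gt_eqF// dotp_gt0.
have S0 : S !=set0 by eexists; exact: (nz u u0).
have cS : compact S.
  apply: cV_bounded_closed_compact.
    exists 1; split=> // x x1 w Sw; apply: le_trans (ltW x1).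
    by rewrite -(@ler_pXn2r _ 2%N) ?nnegrE ?expr1n// -Sw sqr_normr_le_dotp.
  have -> : S = (fun w : 'cV[R]_r => dotp w w) @^-1` [set 1] by [].
  by apply: closed_comp => [w _|]; [exact: cdot|exact: closed_eq].
have cq : {within S, continuous (fun w : 'cV[R]_r => dotp w (L *m w))}.
  apply: continuous_subspaceT; apply: continuous_dotp; last exact: continuous_mulmx.
  by move=> x; exact: cvg_id.
have [w0 /set_mem Sw0 max0] := compact_EVT_max S0 cS cq.
set mu := dotp w0 (L *m w0) in max0.
have ray w : dotp w (L *m w) <= mu * dotp w w.
  have [->|wn0] := eqVneq w 0; first by rewrite !dotp0l mulr0.
  have := max0 _ (mem_set (nz w wn0)).
  rewrite -scalemxAr !dotp_bilin mulrA -expr2 exprVn sqr_sqrtr ?dotp_ge0//.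
  by rewrite -ler_pdivrMr ?dotp_gt0// mulrC.
have MT : (mu%:M - L)^T = mu%:M - L by rewrite linearB/= tr_scalar_mx LT.
have eig : (mu%:M - L) *m w0 = 0.
  apply: psd_kernel => // [w|].
    by rewrite mulmxBl mul_scalar_mx !dotp_bilin subr_ge0 ray.
  by rewrite mulmxBl mul_scalar_mx !dotp_bilin Sw0 mulr1 subrr.
(* [eigenvalue] concerns row vectors multiplied on the left of the matrix; symmetry of [L] allows
   the maximizer to be transposed. *)
have evmu : eigenvalue L mu.
  apply/eigenvalueP; exists w0^T.
    apply: trmx_inj; rewrite trmx_mul linearZ/= !trmxK LT.
    by move/eqP: eig; rewrite mulmxBl mul_scalar_mx subr_eq0 => /eqP ->.
  rewrite -trmx0; apply/eqP => /trmx_inj w00; move: Sw0; rewrite /S/= w00 dotp0l.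
  by apply/eqP; rewrite eq_sym oner_neq0.
apply: le_trans (ray u) _; rewrite ler_wpM2r ?dotp_ge0//.
(* A [sup] dominates the members of a set only if the set is bounded above. Here [mu] is a bound,
   because the Rayleigh quotient at an eigenvector is its eigenvalue. *)
apply: ub_le_sup evmu; exists mu => l /eigenvalueP[w lw wn0].
have wt0 : w^T != 0 by apply: contra_neq wn0; rewrite -trmx0; exact: trmx_inj.
rewrite -(@ler_pM2r _ (dotp w^T w^T)) ?dotp_gt0// -dotpZr.
apply: le_trans (ray w^T); rewrite le_eqVlt; apply/orP; left; apply/eqP.
by congr dotp; rewrite -LT -trmx_mul lw linearZ.
Qed.

(* If [0 <= L <= I], then [L - L^2 = L (I - L) L + (I - L) L (I - L)] is positive
   semidefinite. *)
Lemma sqr_form_le (L : 'M[R]_r) (l : R) u : L^T = L ->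
    (forall w, 0 <= dotp w (L *m w)) ->
    (forall w, dotp w (L *m w) <= l * dotp w w) -> l <= 1 ->
  dotp (L *m u) (L *m u) <= dotp u (L *m u).
Proof.
move=> LT L0 L1 l1; have := L0 (u - L *m u); have := L1 (L *m u).
have := dotp_ge0 (L *m u).
rewrite mulmxBr !dotp_bilin !(dotp_mul_sym u _ LT).
set a := dotp (L *m u) (L *m u).
set b := dotp _ u; set c := dotp (L *m u) (L *m (L *m u)) => a0 H1 H2.
have la : l * a <= a by rewrite ler_piMl.
lra.
Qed.

End SymmetricForms.

(** * The graph Laplacian *)

Section Blocks.
Variables (R : realType) (n q : nat).
Implicit Types (x y : 'cV[R]_(n * q)) (u : 'I_n -> 'cV[R]_q).

Lemma blockD x y i : block (x + y) i = block x i + block y i.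
Proof. by apply/colP => k; rewrite !mxE. Qed.

Lemma blockN x i : block (- x) i = - block x i.
Proof. by apply/colP => k; rewrite !mxE. Qed.

Lemma blockB x y i : block (x - y) i = block x i - block y i.
Proof. by rewrite blockD blockN. Qed.

Lemma blockZ (a : R) x i : block (a *: x) i = a *: block x i.
Proof. by apply/colP => k; rewrite !mxE. Qed.

Lemma block_stack u i : block (stack u) i = u i.
Proof. by apply/colP => k; rewrite !mxE mxtens_indexK. Qed.

Lemma eq_blocks x y : (forall i, block x i = block y i) -> x = y.
Proof.
move=> xy; apply/colP => k; rewrite -(mxtens_unindexK k).
case: (mxtens_unindex k) => i l.
by have /colP/(_ l) := xy i; rewrite !mxE.
Qed.

Lemma sum_mxtens (V : zmodType) (F : 'I_(n * q) -> V) :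
  \sum_k F k = \sum_i \sum_l F (mxtens_index (i, l)).
Proof.
rewrite pair_bigA/= (reindex (@mxtens_index n q)); last first.
  exists (@mxtens_unindex n q) => k _; first exact: mxtens_indexK.
  exact: mxtens_unindexK.
by apply: eq_bigr => -[].
Qed.

Lemma dotp_blocks x y : dotp x y = \sum_i dotp (block x i) (block y i).
Proof.
rewrite dotpE sum_mxtens; apply: eq_bigr => i _; rewrite dotpE.
by apply: eq_bigr => l _; rewrite !mxE.
Qed.

(** Unlike blocks, slices are preserved by [M *t 1], which acts as [M] on each of them; bounds for
    the Laplacian thus carry over to [laplacian_nq] slice by slice. *)
Definition slice x (l : 'I_q) : 'cV[R]_n := \col_i x (mxtens_index (i, l)) 0.

Lemma dotp_slices x y : dotp x y = \sum_l dotp (slice x l) (slice y l).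
Proof.
rewrite dotpE sum_mxtens exchange_big; apply: eq_bigr => l _; rewrite dotpE.
by apply: eq_bigr => i _; rewrite !mxE.
Qed.

Lemma slice_tens_mul (M : 'M[R]_n) x l :
  slice ((M *t (1%:M : 'M[R]_q)) *m x) l = M *m slice x l.
Proof.
apply/colP => i; rewrite !mxE sum_mxtens; apply: eq_bigr => j _.
rewrite (bigD1 l)//= big1 => [|m ml]; rewrite tensmxE !mxE.
  by rewrite eqxx mulr1 addr0.
by rewrite eq_sym (negbTE ml) mulr0 mul0r.
Qed.

Lemma block_continuous i : continuous (fun x => block x i).
Proof.
apply: mx_continuous => k j; under eq_fun do rewrite mxE.
exact: coord_continuous.
Qed.

Lemma stack_continuous (T : topologicalType) (f : T -> 'I_n -> 'cV[R]_q) :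
  (forall i, continuous (fun t => f t i)) -> continuous (fun t => stack (f t)).
Proof.
move=> cf; apply: mx_continuous => k j; under eq_fun do rewrite mxE.
move=> t; case: (mxtens_unindex k) => i l /=.
exact: (cvg_comp _ _ (cf i t) (@coord_continuous _ _ _ l 0 (f t i))).
Qed.

End Blocks.

Section Laplacian.
Variables (R : realType) (n : nat) (e : rel 'I_n) (A : 'M[R]_n).
Hypothesis graph_eA : weighted_graph e A.

Lemma laplacian_sym : (laplacian A)^T = laplacian A.
Proof.
case: graph_eA => _ _ Asym _ _; apply/matrixP => i j; rewrite !mxE.
by rewrite Asym; case: eqVneq => [->|ij]; rewrite ?eqxx// !mulr0n.
Qed.

Lemma laplacian_mulE (u : 'cV[R]_n) i :
  (laplacian A *m u) i 0 = \sum_j A i j * (u i 0 - u j 0).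
Proof.
rewrite mulmxBl mxE mul_diag_mx !mxE.
rewrite mulr_suml -sumrB; apply: eq_bigr => j _.
by rewrite mulrBr.
Qed.

(** By symmetry of [A] the form can be written with [i] and [j] exchanged; the sum of the two
    expressions consists of weighted squares. *)
Lemma laplacian_form (u : 'cV[R]_n) : dotp u (laplacian A *m u) =
  2^-1 * \sum_i \sum_j A i j * (u i 0 - u j 0) ^+ 2.
Proof.
have E1 : dotp u (laplacian A *m u) =
    \sum_i \sum_j A i j * u i 0 * (u i 0 - u j 0).
  rewrite dotpE; apply: eq_bigr => i _; rewrite laplacian_mulE mulr_sumr.
  by apply: eq_bigr => j _; rewrite mulrCA mulrA.
have E2 : dotp u (laplacian A *m u) =
    \sum_i \sum_j A i j * u j 0 * (u j 0 - u i 0).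
  rewrite E1 exchange_big; apply: eq_bigr => i _; apply: eq_bigr => j _ /=.
  by case: graph_eA => _ _ ->.
suff <- : dotp u (laplacian A *m u) + dotp u (laplacian A *m u) =
    \sum_i \sum_j A i j * (u i 0 - u j 0) ^+ 2.
  by field.
rewrite {1}E1 E2 -big_split; apply: eq_bigr => i _ /=.
by rewrite -big_split; apply: eq_bigr => j _ /=; ring.
Qed.

Lemma laplacian_psd (u : 'cV[R]_n) : 0 <= dotp u (laplacian A *m u).
Proof.
rewrite laplacian_form mulr_ge0 ?invr_ge0// sumr_ge0// => i _.
rewrite sumr_ge0// => j _; rewrite mulr_ge0 ?sqr_ge0//.
case: graph_eA => _ _ _ Apos A0.
by have [/Apos/ltW//|/A0->] := boolP (e j i).
Qed.

(** This is what makes the bound on [gamma] imply [gamma < 1]. *)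
Lemma lambda_max_laplacian_ge0 : 0 <= lambda_max (laplacian A).
Proof.
(* Without nodes there is no nonzero vector, the spectrum is empty, and [sup] takes its default
   value 0. *)
have [n0|n0] := posnP n.
  rewrite /lambda_max [X in sup X](_ : _ = set0) ?sup0//.
  apply/seteqP; split=> // l /eigenvalueP[w _ /eqP[]].
  by apply/rowP => j; exfalso; have := ltn_ord j; rewrite [X in (_ < X)%N]n0.
pose u : 'cV[R]_n := const_mx 1.
have u0 : 0 < dotp u u.
  apply: dotp_gt0; apply/eqP => /colP/(_ (Ordinal n0)); rewrite !mxE.
  by apply/eqP; rewrite oner_neq0.
rewrite -(pmulr_lge0 _ u0); apply: le_trans (laplacian_psd u) _.
exact/rayleigh_le_lambda_max/laplacian_sym.
Qed.

Variable q : nat.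
Implicit Type x : 'cV[R]_(n * q).

Lemma laplacian_nq_sym : (laplacian_nq q A)^T = laplacian_nq q A.
Proof. by rewrite /laplacian_nq trmx_tens laplacian_sym trmx1. Qed.

Lemma laplacian_nq_psd x : 0 <= dotp x (laplacian_nq q A *m x).
Proof.
rewrite dotp_slices sumr_ge0// => l _.
by rewrite slice_tens_mul laplacian_psd.
Qed.

Lemma laplacian_nq_le_lambda_max x :
  dotp x (laplacian_nq q A *m x) <= lambda_max (laplacian A) * dotp x x.
Proof.
rewrite !dotp_slices mulr_sumr ler_sum// => l _.
by rewrite slice_tens_mul rayleigh_le_lambda_max// laplacian_sym.
Qed.

Lemma stack_coupling x : stack (coupling e A x) = laplacian_nq q A *m x.
Proof.
apply: eq_blocks => i; rewrite block_stack; apply/colP => l.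
transitivity ((slice (laplacian_nq q A *m x) l) i 0); last by rewrite !mxE.
rewrite slice_tens_mul laplacian_mulE summxE big_mkcond; apply: eq_bigr => j _.
case: graph_eA => _ _ _ _ A0.
by rewrite !mxE; case: ifPn => // /A0 ->; rewrite mul0r.
Qed.

End Laplacian.

(** * Proximal operators *)

Lemma seq_argmin (R : realType) (T : eqType) (h : T -> R) (s : seq T) x :
  x \in s -> exists2 y, y \in s & forall z, z \in s -> h y <= h z.
Proof.
elim: s x => // a s IH x _; case: s IH => [_|b s IH].
  by exists a; rewrite ?mem_head// => z; rewrite inE => /eqP ->.
have [y ys ymin] := IH b (mem_head _ _).
have [ay|/ltW ya] := leP (h a) (h y).
  exists a; rewrite ?mem_head// => z; rewrite inE => /predU1P[->//|/ymin].
  exact: le_trans.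
exists y; first by rewrite in_cons ys orbT.
by move=> z; rewrite in_cons => /predU1P[->//|/ymin].
Qed.

(** Without a minimizer, the open sets where [g] exceeds a finite value [g y], for [y] in [K], cover
    [K]. In a finite subcover, the centre with the least value belongs to none of the sets. *)
Lemma lsc_compact_min (R : realType) (T : ptopologicalType) (g : T -> \bar R)
    (K : set T) :
  (forall x, g x <> -oo%E) -> lower_semicontinuous g -> compact K ->
  K !=set0 -> exists2 x, K x & forall y, K y -> (g x <= g y)%E.
Proof.
move=> gNy /lower_semicontinuousP lscg; rewrite compact_cover => cK [k Kk].
apply: contrapT => nomin.
have nex x : K x -> exists2 y, K y /\ g y \is a fin_num & (g y < g x)%E.
  move=> Kx; apply: contrapT => H; apply: nomin; exists x => // y Ky.
  rewrite leNgt; apply/negP => yx; apply: H; exists y => //; split=> //.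
  rewrite fin_numE; apply/andP; split; first exact/eqP/gNy.
  by rewrite -ltey; apply: lt_le_trans yx (leey _).
pose D := [set y | K y /\ g y \is a fin_num].
have [||D' D'D cov] := cK T D (fun y => [set x | ((fine (g y))%:E < g x)%E]).
- by move=> y _; exact: lscg.
- by move=> x Kx; have [y [Ky gy] yx] := nex _ Kx; exists y; rewrite //= fineK.
have [k' k'D _] := cov _ Kk.
have [i iD imin] :=
  seq_argmin (fun y => fine (g y)) (k'D : k' \in finmap.enum_fset D').
have [Ki gi] := set_mem (D'D _ iD).
have [j jD] := cov _ Ki.
by rewrite /= -(fineK gi) lte_fin ltNge => /negP; apply; exact: imin.
Qed.

(** Finiteness at [p] is included so that the inequalities at two points can be added as real
    inequalities. *)
Definition subgradient (R : realType) (r : nat) (f : 'cV[R]_r -> \bar R)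
    (p g : 'cV[R]_r) : Prop :=
  f p \is a fin_num /\ forall y, (f p + (dotp g (y - p))%:E <= f y)%E.

Lemma subgradient_monotone (R : realType) (r : nat) (f : 'cV[R]_r -> \bar R)
    (p1 p2 g1 g2 : 'cV[R]_r) :
  subgradient f p1 g1 -> subgradient f p2 g2 ->
  0 <= dotp (g1 - g2) (p1 - p2).
Proof.
move=> [f1 H1] [f2 H2]; have := H1 p2; have := H2 p1.
rewrite -(fineK f1) -(fineK f2) -!EFinD !lee_fin !dotp_bilin; lra.
Qed.

Section Prox.
Variables (R : realType) (r : nat) (f : 'cV[R]_r -> \bar R).
Hypothesis fP : lsc_closed_proper_convex f.
Implicit Types (x y p eta : 'cV[R]_r).

Let fNy x : f x <> -oo%E.
Proof. by case: fP => _ _ []. Qed.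

Lemma compact_cV_ball x (a : R) : compact [set y : 'cV[R]_r | `|y - x| <= a].
Proof.
apply: cV_bounded_closed_compact.
  exists (`|x| + a); split=> [|b]; first exact: num_real.
  move=> ab y /= ya; apply: le_trans (ltW ab).
  by rewrite -(subrK x y) addrC (le_trans (ler_normD _ _))// lerD.
have -> : [set y : 'cV[R]_r | `|y - x| <= a] =
    (fun y => `|y - x|) @^-1` [set t | t <= a] by [].
apply: closed_comp => [y _|]; last exact: closed_le.
exact: continuous_dist.
Qed.

(** Convexity limits the decrease of [f] to a linear rate. Let [m] be its minimum on the unit ball
    around [x0]; for [y] outside, the point of the segment from [x0] to [y] at distance 1 from [x0]
    has value at least [m], and this bounds [f y] from below with slope [m - f x0]. The bound makes
    the proximal objective coercive. *)
Lemma convex_lsc_lower_bound : exists m c : R, exists x0,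
  0 <= c /\ forall y, ((m - c * `|y - x0|)%:E <= f y)%E.
Proof.
case: fP => lscf _ [_ [x0 fx0]] cvxf.
have [|p Kp pmin] :=
    lsc_compact_min fNy lscf (compact_cV_ball (x := x0) (a := 1)).
  by exists x0; rewrite /= subrr normr0.
have fp : f p \is a fin_num.
  rewrite fin_numE; apply/andP; split; first exact/eqP/fNy.
  rewrite -ltey; apply: le_lt_trans (pmin x0 _) _.
    by rewrite /= subrr normr0.
  by move: fx0; rewrite fin_numE ltey => /andP[].
set m := fine (f p); set b := fine (f x0).
have mb : m <= b.
  by rewrite -lee_fin !fineK//; apply: pmin; rewrite /= subrr normr0.
exists m, (b - m), x0; split=> [|y]; first by rewrite subr_ge0.
set d := `|y - x0|; have d0 : 0 <= d by exact: normr_ge0.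
have [d1|d1] := leP d 1.
  apply: (@le_trans _ _ m%:E); last by rewrite fineK//; exact: pmin.
  by rewrite lee_fin gerBl// mulr_ge0// subr_ge0.
have dp : 0 < d by apply: lt_trans d1.
case fy : (f y) => [s| |]; [|exact: leey|case: (fNy fy)].
have id1 : d^-1 <= 1 by rewrite invf_le1// ltW.
have := cvxf y x0 d^-1 _ id1; rewrite invr_ge0 => /(_ d0).
have Kq : `|(d^-1 *: y + (1 - d^-1) *: x0) - x0| <= 1.
  have -> : d^-1 *: y + (1 - d^-1) *: x0 - x0 = d^-1 *: (y - x0).
    by apply/colP => i; rewrite !mxE; ring.
  by rewrite normrZ gtr0_norm ?invr_gt0// mulVf// gt_eqF.
move=> /(le_trans (pmin _ Kq)); rewrite fy -(fineK fp) -(fineK fx0) -/m -/b.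
rewrite -!EFinM -EFinD !lee_fin => H.
have := ler_wpM2l d0 H.
have -> : d * (d^-1 * s + (1 - d^-1) * b) = s + (d - 1) * b.
  by field; rewrite gt_eqF.
nra.
Qed.

Let obj eta x : \bar R := (f x + (2^-1 * enorm (x - eta) ^+ 2)%:E)%E.

Lemma prox_exists eta : exists p, forall y, (obj eta p <= obj eta y)%E.
Proof.
case: (fP) => lscf _ [_ [x0 fx0]] _.
have [m [c [x1 [c0 low]]]] := convex_lsc_lower_bound.
pose G := fine (f x0) + 2^-1 * enorm (x0 - eta) ^+ 2.
pose k := m - c * `|eta - x1| - G.
(* For [t > rho], both [t > 2] and [t / 2 - c > 1 + |k|] hold, so [t ^+ 2 / 2 - c * t] exceeds
   [|k|]. *)
pose rho := 2 * c + 2 + 2 * `|k|.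
have out y : rho < `|y - eta| -> (obj eta x0 < obj eta y)%E.
  set t := `|y - eta| => rt.
  have tri : `|y - x1| <= t + `|eta - x1|.
    by rewrite -(subrKA eta) ler_normD.
  have sq : t ^+ 2 <= enorm (y - eta) ^+ 2 by rewrite enorm_sqr sqr_normr_le_dotp.
  have -> : obj eta x0 = G%:E by rewrite /obj -(fineK fx0).
  have H : ((m - c * `|y - x1| + 2^-1 * enorm (y - eta) ^+ 2)%:E <= obj eta y)%E.
    by rewrite /obj EFinD leeD2r.
  apply: lt_le_trans H; rewrite lte_fin.
  have H1 : c * `|y - x1| <= c * (t + `|eta - x1|) by rewrite ler_wpM2l.
  have k0 : - `|k| <= k by rewrite lerNl -normrN ler_norm.
  have kk : 0 <= `|k| by [].
  suff : 0 < k - c * t + 2^-1 * t ^+ 2.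
    rewrite /k; move: (`|y - x1|) H1 => ny H1; move: (`|eta - x1|) H1 => ne H1.
    move: (enorm (y - eta) ^+ 2) sq => E sq; lra.
  move: rt; rewrite /rho; clear -k0 kk c0; move: `|k| k0 kk => K k0 kk rt.
  nra.
have lscobj : lower_semicontinuous (obj eta).
  move=> x a; rewrite /obj.
  set N := fun x : 'cV[R]_r => 2^-1 * enorm (x - eta) ^+ 2.
  rewrite -/(N x) => ax.
  have cN : continuous N.
    have -> : N = fun x : 'cV[R]_r => 2^-1 * dotp (x - eta) (x - eta).
      by apply/funext => y; rewrite /N enorm_sqr.
    apply: continuousMl; apply: continuous_dotp; exact: continuousBr.
  (* The slack is shared between the summands: near [x] the quadratic part may lose [e] while [f]
     stays above [a - N x + e]. Half of the gap serves when [f x] is finite, any [e] otherwise. *)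
  have [e e0 ae] : exists2 e : R, 0 < e & ((a - N x + e)%:E < f x)%E.
    case fx : (f x) => [s| |]; last by case: (fNy fx).
      move: ax; rewrite fx -EFinD lte_fin => ax.
      by exists ((s - (a - N x)) / 2); rewrite ?lte_fin; lra.
    by exists 1; rewrite ?ltry.
  have [V Vx HV] := lscf x _ ae.
  exists (V `&` [set y | N x - e < N y]).
    have Nx : N x - e < N x by rewrite ltrBlDr ltrDl.
    by apply: filterI => //; exact: (near_gt_continuous cN Nx).
  move=> y [/HV Vy /= Ny].
  case fy : (f y) => [s| |]; [|by rewrite addye// ltry|case: (fNy fy)].
  by move: Vy; rewrite fy -/(N y) -EFinD !lte_fin; lra.
have objNy x : obj eta x <> -oo%E.
  rewrite /obj; case fx : (f x) => [s| |] //; case: (fNy fx).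
(* The radius is enlarged so that [K] contains [x0], the point with which all points outside [K] are
   compared. *)
pose K := [set y : 'cV[R]_r | `|y - eta| <= Num.max rho `|x0 - eta|].
have Kx0 : K x0 by rewrite /K /= le_max lexx orbT.
have [|p Kp pmin] :=
    lsc_compact_min objNy lscobj (@compact_cV_ball eta _ : compact K).
  by exists x0.
exists p => y; have [Ky|] := leP `|y - eta| (Num.max rho `|x0 - eta|).
  exact: pmin.
rewrite gt_max => /andP[/out + _] => /ltW; apply: le_trans; exact: pmin.
Qed.

Lemma prox_min eta y : (obj eta (prox f eta) <= obj eta y)%E.
Proof.
by have := xgetPex 0 (prox_exists eta); apply.
Qed.

(** The minimizer [p] is compared with the points [p + t (y - p)] of a segment. Convexity bounds [f]
    there linearly in [t], the square contributes [- t D + t^2 N / 2], and division by [t] gives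
    [key]; a small [t] concludes. *)
Lemma prox_subgradient eta : subgradient f (prox f eta) (eta - prox f eta).
Proof.
set p := prox f eta; case: (fP) => _ _ [_ [x0 fx0]] cvxf.
have fp : f p \is a fin_num.
  rewrite fin_numE; apply/andP; split; first exact/eqP/fNy.
  apply/eqP => fpy; have := prox_min eta x0; rewrite /obj -/p fpy addye//.
  by rewrite -(fineK fx0) -EFinD leye_eq.
split=> // y.
case fy : (f y) => [b| |]; [|exact: leey|case: (fNy fy)].
rewrite -(fineK fp) -EFinD lee_fin; set a := fine (f p).
set D := dotp _ _; set N := dotp (y - p) (y - p).
have N0 : 0 <= N by exact: dotp_ge0.
have key t : 0 < t -> t <= 1 -> D - (b - a) <= 2^-1 * t * N.
  move=> t0 t1; have := cvxf y p t (ltW t0) t1; set pt := t *: y + _.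
  rewrite fy -(fineK fp) -/a -!EFinM -EFinD.
  have := prox_min eta pt; rewrite /obj -/p -(fineK fp) -/a.
  case fpt : (f pt) => [s| |]; [| |case: (fNy fpt)].
    rewrite -!EFinD !lee_fin => H1 H2.
    have E : enorm (pt - eta) ^+ 2 =
        enorm (p - eta) ^+ 2 - 2 * t * D + t ^+ 2 * N.
      have -> : pt - eta = (p - eta) + t *: (y - p).
        by apply/colP => i; rewrite !mxE; ring.
      rewrite !enorm_sqr /D /N -(opprB eta p) !dotp_bilin.
      move: (dotp_bilin); clear; move=> _.
      rewrite (dotpC p eta) (dotpC y eta) (dotpC p y); ring.
    have : t * (D - (b - a)) <= t * (2^-1 * t * N) by rewrite E in H1; lra.
    by rewrite ler_pM2l.
  by rewrite leye_eq.
rewrite leNgt; apply/negP => H; set ep := D - (b - a).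
have ep0 : 0 < ep by rewrite /ep; lra.
have s0 : 0 < N + ep by lra.
(* This one value of [t] replaces the limit at 0: it is at most 1, and the bound becomes [ep] times
   [N / (2 (N + ep))], a factor below 1. *)
have := key (ep / (N + ep)); rewrite divr_gt0// ler_pdivrMr// mul1r.
move=> /(_ isT); rewrite lerDr => /(_ N0); rewrite -/ep.
have -> : 2^-1 * (ep / (N + ep)) * N = ep * (2^-1 * N / (N + ep)) by ring.
rewrite -[leLHS]mulr1 ler_pM2l// ler_pdivlMr//; lra.
Qed.

(** With [u = x - y] and [w] the difference of the proximal points, monotonicity gives
    [|w|^2 <= u.w], and [|u - w|^2 >= 0] then gives [|w|^2 <= |u|^2]. *)
Lemma prox_nonexpansive x y :
  dotp (prox f x - prox f y) (prox f x - prox f y) <= dotp (x - y) (x - y).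
Proof.
have := subgradient_monotone (prox_subgradient x) (prox_subgradient y).
have := dotp_ge0 ((x - y) - (prox f x - prox f y)).
set p := prox f x; set p' := prox f y.
have -> : x - p - (y - p') = (x - y) - (p - p').
  by apply/colP => i; rewrite !mxE; ring.
move: (x - y) (p - p') => u w; rewrite !dotp_bilin (dotpC w u); lra.
Qed.

Lemma prox_continuous : continuous (prox f).
Proof.
move=> x; apply: (@cvg_sqr_dist _ _ _ _ _ (fun y => dotp (x - y) (x - y))).
- by apply: continuous_dotp; exact: continuousBl.
- by rewrite subrr dotp0l.
- by move=> y; apply: le_trans (prox_nonexpansive _ _); exact: sqr_normr_le_dotp.
Qed.

End Prox.

(** * Derivatives along trajectories *)

Section Derivatives.
Variable R : realType.

Lemma is_derive_comp_diff (V W : normedModType R) (f : V -> W) (y : R -> V)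
    (t : R) (dy : V) :
  differentiable f (y t) -> is_derive t 1 y dy ->
  is_derive t 1 (f \o y) ('d f (y t) dy).
Proof.
move=> df [dery <-]; have dify : differentiable y t by apply/derivable1_diffP.
have difc := differentiable_comp dify df.
apply: DeriveDef; first exact/derivable1_diffP.
by rewrite deriveE// diff_comp//= deriveE.
Qed.

Lemma is_derive_coord m n (M : R -> 'M[R]_(m, n)) (t : R) dM i j :
  is_derive t 1 M dM -> is_derive t 1 (fun t => M t i j) (dM i j).
Proof.
move=> [derM <-]; apply: DeriveDef; first exact: (derivable_mxP M t 1).1.
by rewrite derive_mx// mxE.
Qed.

Lemma is_derive_mx m n (M : R -> 'M[R]_(m, n)) (t : R) (dM : 'M[R]_(m, n)) :
  (forall i j, is_derive t 1 (fun t => M t i j) (dM i j)) -> is_derive t 1 M dM.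
Proof.
move=> H.
have derM : derivable M t 1 by apply/derivable_mxP => i j; case: (H i j).
apply: DeriveDef => //; rewrite derive_mx//.
by apply/matrixP => i j; rewrite mxE; case: (H i j).
Qed.

Lemma is_derive_sumr n (h : 'I_n -> R -> R) (t : R) (dh : 'I_n -> R) :
  (forall i, is_derive t 1 (h i) (dh i)) ->
  is_derive t 1 (fun t => \sum_i h i t) (\sum_i dh i).
Proof.
move=> H; have -> : (fun t => \sum_i h i t) = \sum_i h i.
  by apply/funext => u; rewrite fct_sumE.
exact: is_derive_sum.
Qed.

Lemma is_derive_cstr (V : normedModType R) (a : V) (t : R) :
  is_derive t 1 (fun=> a) 0.
Proof. exact: (is_derive_cst a t 1). Qed.

Lemma is_derive_subv (V : normedModType R) (f g : R -> V) (t : R) df dg :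
  is_derive t 1 f df -> is_derive t 1 g dg ->
  is_derive t 1 (fun t => f t - g t) (df - dg).
Proof.
by move=> Hf Hg; rewrite (_ : (fun t => _) = f - g)//; exact: is_deriveB.
Qed.

Lemma is_derive_addr (f g : R -> R) (t : R) df dg :
  is_derive t 1 f df -> is_derive t 1 g dg ->
  is_derive t 1 (fun t => f t + g t) (df + dg).
Proof.
by move=> Hf Hg; rewrite (_ : (fun t => _) = f + g)//; exact: is_deriveD.
Qed.

Lemma is_derive_subr (f g : R -> R) (t : R) df dg :
  is_derive t 1 f df -> is_derive t 1 g dg ->
  is_derive t 1 (fun t => f t - g t) (df - dg).
Proof.
by move=> Hf Hg; rewrite (_ : (fun t => _) = f - g)//; exact: is_deriveB.
Qed.

Lemma is_derive_mulr (f g : R -> R) (t df dg : R) :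
  is_derive t 1 f df -> is_derive t 1 g dg ->
  is_derive t 1 (fun t => f t * g t) (df * g t + f t * dg).
Proof.
move=> Hf Hg; rewrite (_ : (fun t => _) = f * g)//.
apply: (is_derive_eq (is_deriveM Hf Hg)).
by rewrite addrC; congr (_ + _); rewrite mulrC.
Qed.

Lemma is_derive_dotp r (u w : R -> 'cV[R]_r) (t : R) du dw :
  is_derive t 1 u du -> is_derive t 1 w dw ->
  is_derive t 1 (fun t => dotp (u t) (w t)) (dotp du (w t) + dotp (u t) dw).
Proof.
move=> Hu Hw; under eq_fun do rewrite dotpE.
rewrite !dotpE -big_split; apply: is_derive_sumr => k /=.
by apply: is_derive_mulr; exact: is_derive_coord.
Qed.

Lemma is_derive_mulmx m n (M : 'M[R]_(m, n)) (u : R -> 'cV[R]_n) (t : R) du :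
  is_derive t 1 u du -> is_derive t 1 (fun t => M *m u t) (M *m du).
Proof.
move=> Hu; apply: is_derive_mx => i j; under eq_fun do rewrite mxE.
rewrite mxE; apply: is_derive_sumr => k.
apply: (is_derive_eq (is_derive_mulr (is_derive_cstr (M i k) t)
  (is_derive_coord k j Hu))).
by rewrite mul0r add0r.
Qed.

Lemma is_derive_block n q (x : R -> 'cV[R]_(n * q)) (t : R) dx i :
  is_derive t 1 x dx -> is_derive t 1 (fun t => block (x t) i) (block dx i).
Proof.
move=> Hx; apply: is_derive_mx => k j; under eq_fun do rewrite mxE.
by rewrite mxE; exact: is_derive_coord.
Qed.

Lemma diff_gradient r (f : 'cV[R]_r -> R) x h :
  differentiable f x -> 'd f x h = dotp (gradient f x) h.
Proof.
move=> df; rewrite {1}(sum_delta h) linear_sum dotpE; apply: eq_bigr => k _.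
by rewrite linearZ/= mxE /partial deriveE// [RHS]mulrC.
Qed.

Lemma is_derive_gradient r (f : 'cV[R]_r -> R) (y : R -> 'cV[R]_r) (t : R) dy :
  differentiable f (y t) -> is_derive t 1 y dy ->
  is_derive t 1 (fun t => f (y t)) (dotp (gradient f (y t)) dy).
Proof. by move=> df Hy; rewrite -diff_gradient//; exact: is_derive_comp_diff. Qed.

(** Derivatives are asked for only inside the interval because a trajectory has merely a right
    derivative at time 0. *)
Lemma mvt_point (phi d : R -> R) (a b : R) : a < b ->
    {within `[a, b], continuous phi} ->
    (forall t, a < t -> t < b -> is_derive t 1 phi (d t)) ->
  exists t, [/\ a < t, t < b & phi b - phi a = d t * (b - a)].
Proof.
move=> ab cphi Hd.
have Hd' t : t \in `]a, b[%R -> is_derive t 1 phi (d t).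
  by rewrite in_itv/= => /andP[]; exact: Hd.
have [t] := MVT ab Hd' cphi; rewrite in_itv/= => /andP[at_ tb] E.
by exists t.
Qed.

Lemma mvt_le (phi d : R -> R) (a b c : R) : a <= b ->
    {within `[a, b], continuous phi} ->
    (forall t, a < t -> t < b -> is_derive t 1 phi (d t)) ->
    (forall t, a < t -> t < b -> d t <= c) ->
  phi b - phi a <= c * (b - a).
Proof.
rewrite le_eqVlt => /predU1P[->|ab]; first by rewrite !subrr mulr0.
move=> cphi Hd dc; have [t [at_ tb ->]] := mvt_point ab cphi Hd.
by rewrite ler_wpM2r ?subr_ge0 ?(ltW ab)// dc.
Qed.

Lemma mvt_norm_le (phi d : R -> R) (a b c : R) : a <= b ->
    {within `[a, b], continuous phi} ->
    (forall t, a < t -> t < b -> is_derive t 1 phi (d t)) ->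
    (forall t, a < t -> t < b -> `|d t| <= c) ->
  `|phi b - phi a| <= c * (b - a).
Proof.
rewrite le_eqVlt => /predU1P[->|ab]; first by rewrite !subrr mulr0 normr0.
move=> cphi Hd dc; have [t [at_ tb ->]] := mvt_point ab cphi Hd.
have ab0 : 0 <= b - a by rewrite subr_ge0 ltW.
by rewrite normrM (ger0_norm ab0) ler_wpM2r// dc.
Qed.

(* The derivative of [f (b + t d) - t <grad f b, d> - c t^2 |d|^2 / 2] at [t] is
   [<grad f (b + t d) - grad f b, t d> / t - c t |d|^2 >= 0]. *)
Lemma strongly_convex_lower_bound r (f : 'cV[R]_r -> R) (c : R) a b :
  (forall x, differentiable f x) -> strongly_convex c f ->
  f b + dotp (gradient f b) (a - b) + 2^-1 * c * dotp (a - b) (a - b) <= f a.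
Proof.
move=> df sc; set d := a - b; set g := dotp (gradient f b) d.
set N := dotp d d; pose y (t : R) := b + t *: d.
have Hy (t : R) : is_derive t 1 y d.
  apply: is_derive_mx => i j.
  have -> : (fun t => y t i j) = (fun t => b i j + t * d i j).
    by apply/funext => u; rewrite !mxE.
  apply: (is_derive_eq (is_derive_addr (is_derive_cstr (b i j) t)
    (is_derive_mulr (is_derive_id t 1) (is_derive_cstr (d i j) t)))).
  by rewrite mulr0 add0r addr0 mul1r.
pose psi t := t * g + 2^-1 * c * N * (t * t) - f (y t).
pose dpsi t := g + 2^-1 * c * N * (t + t) - dotp (gradient f (y t)) d.
have Hpsi (t : R) : is_derive t 1 psi (dpsi t).
  have Hid := is_derive_id t (1 : R).
  apply: (is_derive_eq (is_derive_subr (is_derive_addr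
    (is_derive_mulr Hid (is_derive_cstr g t))
    (is_derive_mulr (is_derive_cstr (2^-1 * c * N) t) (is_derive_mulr Hid Hid)))
    (is_derive_gradient (df _) (Hy t)))).
  by rewrite /dpsi; ring.
have : psi 1 - psi 0 <= 0 * (1 - 0).
  apply: (@mvt_le _ dpsi) => // [|t t0 _].
    apply: derivable_within_continuous => t _; by case: (Hpsi t).
  rewrite /dpsi.
  have : t * (c * t * N - dotp (gradient f (y t) - gradient f b) d) <= 0.
    have -> : t * (c * t * N - dotp (gradient f (y t) - gradient f b) d) =
      c * enorm (y t - b) ^+ 2 - dotp (gradient f (y t) - gradient f b) (y t - b).
      rewrite enorm_sqr /y addrAC subrr add0r !dotpZl !dotpZr /N; ring.
    (* Strong convexity is stated for distinct points; if [y t = b], both sides vanish. *)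
    rewrite subr_le0; have [->|yb] := eqVneq (y t) b.
      by rewrite subrr dotp0r enorm_sqr dotp0r mulr0.
    by apply: sc; exact/eqP.
  rewrite pmulr_rle0// dotpDl dotpNl -/g; lra.
rewrite mul0r /psi /y scale1r scale0r addr0.
have -> : b + d = a by rewrite addrC subrK.
lra.
Qed.

End Derivatives.

(** * Differentiability, continuity and speed of trajectories *)

Section Trajectories.
Variables (R : realType) (S : normedModType R) (F : S -> S) (X : R -> S).
Hypothesis XF : trajectory F X.

(** The identity required of [p] is the part of linearity that acts on difference quotients;
    projections and coordinates of the state satisfy it. *)
Lemma trajectory_is_derive (W : normedModType R) (p : S -> W) (t : R) :
    continuous p -> (forall a s s', p (a *: (s - s')) = a *: (p s - p s')) ->
  0 < t -> is_derive t 1 (p \o X) (p (F (X t))).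
Proof.
move=> cp lp t0.
suff : h^-1 *: ((p \o X \o shift t) (h *: 1) - (p \o X) t) @[h --> 0^'] -->
    p (F (X t)).
  move=> H; apply: DeriveDef; first by apply/cvg_ex; exists (p (F (X t))).
  exact/cvg_lim.
under eq_fun => h do rewrite -lp.
suff H : (fun h => h^-1 *: (X (shift t (h *: 1)) - X t)) h @[h --> 0^']
    --> F (X t).
  exact: (cvg_comp _ _ H (cp (F (X t)))).
apply/cvgrPdist_le => ep ep0.
have /cvgrPdist_le/(_ ep ep0) := XF (ltW t0).
rewrite near_withinE => /nbhs_ballP[d /= d0 Hd].
(* The bound [t] keeps [h + t] nonnegative, so the quotient restricted to the half-line gives a
   two-sided derivative. *)
apply/nbhs_ballP; exists (Num.min d t) => /=; first by rewrite lt_min d0 t0.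
move=> h; rewrite -ball_normE/= sub0r normrN lt_min => /andP[hd ht] h0.
have := Hd (h + t); rewrite -ball_normE/= opprD addrCA subrr addr0 normrN.
move=> /(_ hd); rewrite -subr_eq0 addrK => /(_ h0).
have -> : 0 <= h + t.
  move: ht; rewrite ltr_norml => /andP[].
  by rewrite ltrNl -subr_gt0 opprK addrC => /ltW.
by move=> /(_ isT); rewrite /shift/= [h *: 1]mulr1.
Qed.

Lemma trajectory_continuous (t : R) : 0 <= t ->
  X t' @[t' --> within [set t' | 0 <= t'] (nbhs t)] --> X t.
Proof.
move=> t0; apply/cvgrPdist_le => ep ep0.
have /cvgrPdist_le/(_ 1 ltr01) := XF t0.
rewrite !near_withinE => /nbhs_ballP[d /= d0 Hd].
(* Near [t] the difference quotient is within 1 of [F (X t)], so [K] is a local Lipschitz constant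
   at [t]. *)
set K := `|F (X t)| + 1; have K0 : 0 < K by rewrite ltr_pwDr.
apply/nbhs_ballP; exists (Num.min d (ep / K)) => /=.
  by rewrite lt_min d0 divr_gt0.
move=> t' Bt' t'0; have [->|tt'] := eqVneq t' t.
  by rewrite subrr normr0 ltW.
move: Bt'; rewrite -ball_normE/= lt_min => /andP[td te].
have := Hd t'; rewrite -ball_normE/= => /(_ td tt' t'0).
set Q := _ *: _ => HQ.
have QK : `|Q| <= K.
  rewrite /K -(subrK (F (X t)) Q) addrC (le_trans (ler_normD _ _))// lerD2l.
  by rewrite distrC.
have -> : X t - X t' = (t - t') *: Q.
  by rewrite /Q scalerA -[t - t']opprB mulNr divff ?subr_eq0// scaleN1r opprB.
rewrite normrZ; apply: le_trans (_ : `|t - t'| * K <= _).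
  by rewrite ler_wpM2l.
by rewrite -ler_pdivlMr// ltW.
Qed.

Lemma trajectory_comp_continuous (phi : S -> R) (a b : R) :
  continuous phi -> 0 <= a -> {within `[a, b], continuous (phi \o X)}.
Proof.
move=> cphi a0; apply/subspace_continuousP => t /=; rewrite in_itv/= => /andP[at_ _].
suff H : X t' @[t' --> within `[a, b] (nbhs t)] --> X t.
  exact: (cvg_comp _ _ H (cphi (X t))).
apply: cvg_trans (trajectory_continuous (le_trans a0 at_)).
apply: cvg_app; apply: within_subset => u /=; rewrite in_itv/= => /andP[au _].
exact: le_trans a0 au.
Qed.

(** The mean value theorem is for real functions. The estimate is therefore made for real
    functionals, and the max norm is recovered from the coordinates. *)
Lemma trajectory_functional_speed (p : S -> R) (a b M : R) :
    continuous p -> (forall a s s', p (a *: (s - s')) = a *: (p s - p s')) ->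
    (forall s, `|p s| <= `|s|) ->
    0 <= a -> a <= b -> (forall t, a < t -> `|F (X t)| <= M) ->
  `|p (X b) - p (X a)| <= M * (b - a).
Proof.
move=> cp lp np a0 ab FM.
have Hd t : a < t -> t < b -> is_derive t 1 (p \o X) (p (F (X t))).
  by move=> at_ _; apply: trajectory_is_derive => //; exact: le_lt_trans at_.
have HM t : a < t -> `|p (F (X t))| <= M by move=> /FM; exact: le_trans.
apply: (mvt_norm_le ab _ Hd) => [|t /HM//].
exact: trajectory_comp_continuous.
Qed.

End Trajectories.

(** * Lyapunov functions and LaSalle's principle *)

(* [V] decreases at rate at least [W] along trajectories, and [W] vanishes only
   at equilibria. *)
Definition lyapunov_pair (R : realType) (S : normedModType R) (F : S -> S)
    (s : S) (V W : S -> R) : Prop :=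
  [/\ continuous V /\ V s = 0,
      exists2 k, 0 < k & forall y, k * `|y - s| ^+ 2 <= V y,
      continuous W,
      forall y, 0 <= W y /\ (W y = 0 -> F y = 0) &
      forall X (t : R), trajectory F X -> 0 < t ->
        exists2 d : R, is_derive t 1 (V \o X) d & d <= - W (X t)].

Section Lyapunov.
Variables (R : realType) (S : normedModType R) (F : S -> S).
Variables (s : S) (V W : S -> R).
Hypothesis VW : lyapunov_pair F s V W.

Lemma lyapunov_decrease X (a b c : R) : trajectory F X -> 0 <= a -> a <= b ->
  (forall t, a < t -> t < b -> c <= W (X t)) -> V (X b) <= V (X a) - c * (b - a).
Proof.
case: VW => -[cV _] _ _ _ dV XF a0 ab cW.
rewrite -lerBlDl -mulNr.
apply: (@mvt_le _ (V \o X) ('D_1 (V \o X))) => // [|t at_ tb|t at_ tb].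
- exact: (trajectory_comp_continuous XF cV a0).
- have [|d [dd _] _] := dV X t XF; first exact: le_lt_trans at_.
  exact: derivableP.
- have [|d [_ ->]] := dV X t XF; first exact: le_lt_trans at_.
  by move=> /le_trans; apply; rewrite lerN2 cW.
Qed.

Lemma lyapunov_nonincreasing X (a b : R) : trajectory F X -> 0 <= a -> a <= b ->
  V (X b) <= V (X a).
Proof.
case: VW => _ _ _ W0 _ XF a0 ab.
have := @lyapunov_decrease X a b 0 XF a0 ab; rewrite mul0r subr0; apply.
by move=> t _ _; case: (W0 (X t)).
Qed.

Lemma lyapunov_ge0 y : 0 <= V y.
Proof.
case: VW => _ [k k0 Vk] _ _ _; apply: le_trans (Vk y).
by rewrite mulr_ge0 ?sqr_ge0// ltW.
Qed.

(** A sublevel set of [V] lies in the [eps]-ball by coercivity and is never left. The starting time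
    [t0] is free because [trajectory_cvg] restarts the argument when the trajectory comes close to
    its cluster point. *)
Lemma lyapunov_pair_stable (eps : R) : 0 < eps -> exists2 delta : R, 0 < delta &
  forall X (t0 t : R), trajectory F X -> 0 <= t0 -> t0 <= t ->
    `|X t0 - s| < delta -> `|X t - s| < eps.
Proof.
move=> eps0; case: (VW) => -[cV Vs] [k k0 Vk] _ _ _.
have : \forall y \near s, V y < k * eps ^+ 2.
  apply: (cvgr_lt (V s)); first exact: cV.
  by rewrite Vs mulr_gt0// exprn_gt0.
move=> /nbhs_ballP[d /= d0 Hd]; exists d => // X t0 t XF t00 t0t Xd.
have Vd : V (X t0) < k * eps ^+ 2.
  by apply: Hd; rewrite -ball_normE/= distrC.
have := le_lt_trans (le_trans (Vk (X t)) (lyapunov_nonincreasing XF t00 t0t)) Vd.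
by rewrite ltr_pM2l// ltr_pXn2r ?nnegrE ?(ltW eps0).
Qed.

Lemma lyapunov_pair_bounded X : trajectory F X ->
  exists a : R, forall t, 0 <= t -> `|X t - s| <= a.
Proof.
case: (VW) => _ [k k0 Vk] _ _ _ XF.
exists (Num.sqrt (V (X 0) / k)) => t t0.
rewrite -(@ler_pXn2r _ 2%N) ?nnegrE ?sqrtr_ge0// sqr_sqrtr; last first.
  by rewrite divr_ge0 ?lyapunov_ge0// ltW.
rewrite ler_pdivlMr// mulrC; apply: le_trans (Vk _) _.
exact: lyapunov_nonincreasing.
Qed.

End Lyapunov.

(** * Convergence of trajectories in a space with compact balls *)

Section LaSalle.
Variables (R : realType) (S : normedModType R) (F : S -> S).
Hypothesis cF : continuous F.
Hypothesis compact_ball : forall (s : S) (a : R),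
  compact [set y : S | `|y - s| <= a].
Hypothesis trajectory_speed : forall X (a b M : R), trajectory F X -> 0 <= a ->
  a <= b -> (forall t, a < t -> `|F (X t)| <= M) -> `|X b - X a| <= M * (b - a).

(* Around a cluster point with [W > 0], each visit of the trajectory lasts at
   least a fixed time, during which [V] drops by a fixed amount. *)
Lemma cluster_equilibrium s V W X y : lyapunov_pair F s V W ->
  trajectory F X -> cluster (X t @[t --> +oo]) y -> F y = 0.
Proof.
move=> VW XF cly; case: (VW) => _ _ cW W0 _.
case: (W0 y) => Wy_ge0 Wy; apply: Wy; apply/eqP; rewrite eq_le Wy_ge0 andbT.
rewrite leNgt; apply/negP => Wy_gt0.
have [a Xa] := lyapunov_pair_bounded VW XF.
have [M M0 FM] : exists2 M : R, 0 < M & forall t, 0 <= t -> `|F (X t)| <= M.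
  have := compact_ball (s := s) (a := a).
  move=> /(continuous_compact (continuous_subspaceT cF)) /compact_bounded.
  move=> [M [_ HM]]; exists (Num.max (M + 1) 1); first by rewrite lt_max ltr01 orbT.
  move=> t t0; apply: HM; first by rewrite lt_max ltrDl ltr01.
  by exists (X t) => //; exact: Xa.
set w := W y / 2; have w0 : 0 < w by rewrite divr_gt0.
have : \forall z \near y, w < W z.
  by apply: near_gt_continuous => //; rewrite /w; lra.
move=> /nbhs_ballP[r /= r0 Hr].
(* At speed at most [M], a trajectory found within [r / 2] of [y] stays within [r] of it during a
   time [tau]. *)
set tau := r / 2 / M; have tau0 : 0 < tau by rewrite !divr_gt0.
pose E := [set V (X t) | t in [set t | 0 <= t]].
have infE : has_inf E.
  split; first by exists (V (X 0)), 0 => /=.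
  by exists 0 => _ [t _ <-]; exact: (lyapunov_ge0 VW).
(* From time [T] on, [V] is within [w * tau] of its infimum, but one visit after [T] lowers it by at
   least [w * tau]. *)
have [|_ [T T0 <-] HT] := inf_adherent (eps := w * tau) _ infE.
  by rewrite mulr_gt0.
have HA : (X t @[t --> +oo]) (X @` [set t | T <= t]).
  by exists T; split; [exact: num_real|move=> t /ltW Tt; exists t].
have HB : nbhs y (ball y (r / 2)) by apply: nbhsx_ballx; rewrite divr_gt0.
have [_ [[t Tt <-] Xt]] := cly _ _ HA HB.
have t0 : 0 <= t by apply: le_trans Tt.
have drop : V (X (t + tau)) <= V (X t) - w * (t + tau - t).
  apply: (lyapunov_decrease VW XF) => //; first by rewrite lerDl ltW.
  move=> u tu utau; apply/ltW/Hr; rewrite -ball_normE/=.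
  move: Xt; rewrite -ball_normE/= => Xt.
  rewrite -(subrKA (X t)) (splitr r) (le_lt_trans (ler_normD _ _))//.
  rewrite ltr_leD// distrC.
  have HF v : t < v -> `|F (X v)| <= M.
    by move=> tv; rewrite FM// (le_trans t0)// ltW.
  apply: le_trans (trajectory_speed XF t0 (ltW tu) HF) _.
  by rewrite mulrC -ler_pdivlMr// lerBlDl ltW.
have : inf E <= V (X (t + tau)).
  apply: ge_inf; first by case: infE.
  by exists (t + tau) => //=; rewrite addr_ge0// ltW.
have := lyapunov_nonincreasing VW XF T0 Tt.
move: drop; rewrite addrAC subrr add0r; lra.
Qed.

Lemma trajectory_cvg s V W X : lyapunov_pair F s V W ->
    (forall y, F y = 0 -> exists V' W', lyapunov_pair F y V' W') ->
    trajectory F X ->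
  exists2 y, F y = 0 & X t @[t --> +oo] --> y.
Proof.
move=> VW eqVW XF.
have [a Xa] := lyapunov_pair_bounded VW XF.
have [y [_ cly]] :
    [set y : S | `|y - s| <= a] `&` cluster (X t @[t --> +oo]) !=set0.
  apply: (compact_ball (s := s) (a := a)).
  by exists 0; split; [exact: num_real|move=> t /ltW /Xa].
have Fy := cluster_equilibrium VW XF cly; exists y => //.
have [V' [W' VW']] := eqVW y Fy.
apply/cvgrPdist_lt => ep ep0.
have [d d0 Hd] := lyapunov_pair_stable VW' ep0.
have HA : (X t @[t --> +oo]) (X @` [set t | 0 <= t]).
  by exists 0; split; [exact: num_real|move=> t /ltW t0; exists t].
have [_ [[t0 /= t00 <-] Xt0]] := cly _ _ HA (nbhsx_ballx y d d0).
exists t0; split; first exact: num_real.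
move=> t /ltW t0t; rewrite distrC; apply: (Hd X t0) => //.
by move: Xt0; rewrite -ball_normE/= distrC.
Qed.

End LaSalle.

(** * The algorithm *)

Section State.
Variables (R : realType) (n q : nat).
Local Notation S := (state R n q).
Implicit Type s : S.

Lemma state_norm_le s (a : R) :
  (`|s| <= a) = [&& `|s.1.1| <= a, `|s.1.2| <= a & `|s.2| <= a].
Proof. by rewrite /Num.Def.normr/= /Num.norm/= !ge_max andbA. Qed.

Lemma sqr_state_norm_le s : `|s| ^+ 2 <=
  dotp s.1.1 s.1.1 + dotp s.1.2 s.1.2 + dotp s.2 s.2.
Proof.
have [x0 z0 v0] := And3 (dotp_ge0 s.1.1) (dotp_ge0 s.1.2) (dotp_ge0 s.2).
set d := _ + _; have d0 : 0 <= d by rewrite /d; lra.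
rewrite -(sqr_sqrtr d0) ler_pXn2r ?nnegrE ?sqrtr_ge0// state_norm_le.
have H (u : 'cV[R]_(n * q)) : dotp u u <= d -> `|u| <= Num.sqrt d.
  move=> ud; rewrite -(@ler_pXn2r _ 2%N) ?nnegrE ?sqrtr_ge0// sqr_sqrtr//.
  exact: le_trans (sqr_normr_le_dotp u) ud.
by apply/and3P; split; apply: H; rewrite /d; lra.
Qed.

Lemma state_compact_ball s (a : R) : compact [set y : S | `|y - s| <= a].
Proof.
pose B (c : 'cV[R]_(n * q)) := [set y : 'cV[R]_(n * q) | `|y - c| <= a].
have -> : [set y : S | `|y - s| <= a] = (B s.1.1 `*` B s.1.2) `*` B s.2.
  apply/seteqP; split=> [y|y [[]]] /=; rewrite state_norm_le /B/=.
    by move=> /and3P[].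
  by move=> -> -> ->.
by apply: compact_setX; [apply: compact_setX|]; exact: compact_cV_ball.
Qed.

Lemma state_fst_continuous : continuous (fun s : S => s.1.1).
Proof.
move=> s; exact: (cvg_comp _ _ (@cvg_fst _ _ (nbhs s.1) (nbhs s.2) _)
  (@cvg_fst _ _ (nbhs s.1.1) (nbhs s.1.2) _)).
Qed.

Lemma state_snd_continuous : continuous (fun s : S => s.1.2).
Proof.
move=> s; exact: (cvg_comp _ _ (@cvg_fst _ _ (nbhs s.1) (nbhs s.2) _)
  (@cvg_snd _ _ (nbhs s.1.1) (nbhs s.1.2) _)).
Qed.

Lemma state_thd_continuous : continuous (fun s : S => s.2).
Proof. by move=> s; exact: (@cvg_snd _ _ (nbhs s.1) (nbhs s.2) _). Qed.

Lemma state_trajectory_speed (F : S -> S) X (a b M : R) : trajectory F X ->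
    0 <= a -> a <= b -> (forall t, a < t -> `|F (X t)| <= M) ->
  `|X b - X a| <= M * (b - a).
Proof.
move=> XF a0 ab FM.
have M0 : 0 <= M by apply: le_trans (FM (a + 1) _); rewrite ?ltrDl.
have Mab : 0 <= M * (b - a) by rewrite mulr_ge0// subr_ge0.
have coordE (p : S -> 'cV[R]_(n * q)) : continuous p ->
    (forall a s s', p (a *: (s - s')) = a *: (p s - p s')) ->
    (forall s, `|p s| <= `|s|) -> `|p (X b) - p (X a)| <= M * (b - a).
  move=> cp lp np; rewrite normr_cV_le//; apply/forallP => k; rewrite !mxE.
  apply: (trajectory_functional_speed (p := fun s => p s k 0) XF) => // [s|c s s'|s].
  - exact: (cvg_comp _ _ (cp s) (@coord_continuous _ _ _ k 0 (p s))).
  - by rewrite lp !mxE.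
  - by apply: le_trans (np s); exact: normr_coord_le.
have le3 s : [/\ `|s.1.1| <= `|s|, `|s.1.2| <= `|s| & `|s.2| <= `|s|].
  by apply/and3P; rewrite -state_norm_le.
rewrite state_norm_le; apply/and3P; split.
- apply: (coordE (fun s => s.1.1)) => [s|//|s]; last by case: (le3 s).
  exact: state_fst_continuous.
- apply: (coordE (fun s => s.1.2)) => [s|//|s]; last by case: (le3 s).
  exact: state_snd_continuous.
- apply: (coordE (fun s => s.2)) => [s|//|s]; last by case: (le3 s).
  exact: state_thd_continuous.
Qed.

End State.

(** * Stacked proximal and gradient maps *)

Section PROX.
Variables (R : realType) (n q : nat) (f : 'I_n -> 'cV[R]_q -> \bar R).
Hypothesis fP : forall i, lsc_closed_proper_convex (f i).
Implicit Types x y : 'cV[R]_(n * q).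

Definition PROX x : 'cV[R]_(n * q) := stack (fun i => prox (f i) (block x i)).

Lemma block_PROX x i : block (PROX x) i = prox (f i) (block x i).
Proof. exact: block_stack. Qed.

Lemma PROX_continuous : continuous PROX.
Proof.
apply: stack_continuous => i.
by apply: continuousT_comp; [exact: block_continuous|exact: prox_continuous].
Qed.

Lemma PROX_monotone x y :
  0 <= dotp ((x - PROX x) - (y - PROX y)) (PROX x - PROX y).
Proof.
rewrite dotp_blocks sumr_ge0// => i _.
have := block_PROX x i; have := block_PROX y i.
move: (PROX x) (PROX y) => p p' E' E; rewrite !blockB E E'.
by apply: subgradient_monotone; exact: prox_subgradient.
Qed.

End PROX.

Section SmoothTerms.
Variables (R : realType) (n q : nat) (f0 : 'I_n -> 'cV[R]_q -> R).
Hypothesis f0_diff : forall i x, differentiable (f0 i) x.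
Hypothesis f0_sc : forall i, strongly_convex 1 (f0 i).
Implicit Types x y : 'cV[R]_(n * q).

Lemma dotp_gradF0 x y :
  dotp (gradF0 f0 x) y = \sum_i dotp (gradient (f0 i) (block x i)) (block y i).
Proof. by rewrite dotp_blocks; apply: eq_bigr => i _; rewrite block_stack. Qed.

Lemma sum_f0_lower_bound x y :
  \sum_i f0 i (block y i) + dotp (gradF0 f0 y) (x - y)
    + 2^-1 * dotp (x - y) (x - y) <= \sum_i f0 i (block x i).
Proof.
rewrite dotp_gradF0 dotp_blocks mulr_sumr -!big_split; apply: ler_sum => i _ /=.
rewrite blockD blockN.
have := strongly_convex_lower_bound (block x i) (block y i) (f0_diff i) (f0_sc i).
by rewrite mulr1.
Qed.

Lemma gradF0_monotone x y :
  dotp (x - y) (x - y) <= dotp (gradF0 f0 x - gradF0 f0 y) (x - y).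
Proof.
rewrite !dotp_blocks; apply: ler_sum => i _.
have := block_stack (fun i => gradient (f0 i) (block x i)) i.
have := block_stack (fun i => gradient (f0 i) (block y i)) i.
rewrite -/(gradF0 f0 x) -/(gradF0 f0 y).
move: (gradF0 f0 x) (gradF0 f0 y) => gx gy Ey Ex; rewrite !blockB Ex Ey.
have [->|xy] := eqVneq (block x i) (block y i); first by rewrite subrr !dotp0r.
by rewrite -enorm_sqr -[leLHS]mul1r; apply: f0_sc; exact/eqP.
Qed.

Lemma is_derive_sum_f0 (x : R -> 'cV[R]_(n * q)) (t : R) dx :
  is_derive t 1 x dx -> is_derive t 1 (fun t => \sum_i f0 i (block (x t) i))
    (dotp (gradF0 f0 (x t)) dx).
Proof.
move=> Hx; rewrite dotp_gradF0; apply: is_derive_sumr => i.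
exact: (is_derive_gradient (f0_diff _ _) (is_derive_block i Hx)).
Qed.

Lemma sum_f0_continuous : continuous (fun x => \sum_i f0 i (block x i)).
Proof.
apply: continuous_sumr => i; apply: continuousT_comp.
  exact: block_continuous.
by move=> x; exact: differentiable_continuous.
Qed.

Lemma gradF0_continuous : (forall i, continuous (gradient (f0 i))) ->
  continuous (gradF0 f0).
Proof.
move=> cg; apply: stack_continuous => i; apply: continuousT_comp => //.
exact: block_continuous.
Qed.

End SmoothTerms.

(* [X], [Z] stand for the deviations of [x], [z] from the equilibrium, [dx], [dz]
   for their velocities, [u] for [B x], [b] for [B (v - vs)] and [G] for the
   difference of the gradients of [f^0]. *)
Lemma dissipation_vectors (R : realType) (r : nat) (gamma : R)
    (X Z dx dz u b G : 'cV[R]_r) : 0 < gamma -> gamma < 1 ->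
  0 <= dotp (- dx - G - b - u + gamma *: Z) (X + dx) ->
  0 <= dotp (- (gamma *: Z) - dz) (X + dz) ->
  dotp X X <= dotp G X -> dotp u u <= dotp X u ->
  dotp X dx + gamma * dotp Z dz - gamma * (dotp dx Z + dotp X dz) + dotp X b
    + (dotp G dx + dotp u dx) + (dotp dx b + dotp u u)
  <= - (dotp dx dx + 2^-1 * (1 - gamma) * (dotp dz dz + dotp X X)).
Proof.
move=> g0 g1; have := dotp_young X dz ltr01.
rewrite invr1 !mul1r ler_norml => /andP[Y _].
(* The weight collects [gamma] from the cross term of V1 and 1 from the second proximal
   inequality. *)
have Y' : 0 <= (1 + gamma) * (dotp X X + dotp dz dz + 2 * dotp X dz).
  by rewrite mulr_ge0//; lra.
rewrite !dotp_bilin (dotpC dx X) (dotpC b X) (dotpC b dx) (dotpC u X).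
rewrite (dotpC Z X) (dotpC Z dx) (dotpC dz X).
lra.
Qed.

(** * The Lyapunov function along the algorithm and optimality of equilibria *)

Section Algorithm.
Variables (R : realType) (n q : nat) (e : rel 'I_n) (A : 'M[R]_n).
Variables (f0 : 'I_n -> 'cV[R]_q -> R) (f1 f2 : 'I_n -> 'cV[R]_q -> \bar R).
Variables alpha gamma : R.
Hypothesis graph_eA : weighted_graph e A.
Hypothesis f0_C2 : forall i, twice_continuously_differentiable (f0 i).
Hypothesis f0_sc : forall i, strongly_convex 1 (f0 i).
Hypothesis f1_cvx : forall i, lsc_closed_proper_convex (f1 i).
Hypothesis f2_cvx : forall i, lsc_closed_proper_convex (f2 i).
Hypothesis alpha_gt0 : 0 < alpha.
Hypothesis gamma_gt0 : 0 < gamma.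
Hypothesis gamma_lt : gamma < 1 - alpha * lambda_max (laplacian A).

Local Notation S := (state R n q).
Local Notation vec := 'cV[R]_(n * q).
Local Notation F := (algorithm e A f0 f1 f2 alpha gamma).
Local Notation B := (alpha *: laplacian_nq q A).
Implicit Types (s star : S) (x y : vec).

Let f0_diff i (w : 'cV[R]_q) : differentiable (f0 i) w.
Proof. by case: (f0_C2 i). Qed.

Lemma scaled_laplacian_sym : B^T = B.
Proof. by rewrite linearZ/= (laplacian_nq_sym graph_eA). Qed.

Lemma scaled_laplacian_psd x : 0 <= dotp x (B *m x).
Proof.
rewrite -scalemxAl dotpZr mulr_ge0 ?(ltW alpha_gt0)//.
exact: laplacian_nq_psd graph_eA _ _.
Qed.

Lemma scaled_laplacian_le x : dotp x (B *m x) <= (1 - gamma) * dotp x x.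
Proof.
rewrite -scalemxAl dotpZr.
have := ler_wpM2l (ltW alpha_gt0) (laplacian_nq_le_lambda_max graph_eA x).
move=> /le_trans; apply; rewrite mulrA ler_wpM2r ?dotp_ge0//.
by rewrite lerBrDl -lerBrDr ltW.
Qed.

Lemma gamma_lt1 : gamma < 1.
Proof.
apply: lt_le_trans gamma_lt _; rewrite gerBl mulr_ge0 ?(ltW alpha_gt0)//.
exact: lambda_max_laplacian_ge0 graph_eA.
Qed.

Lemma algorithmE s : F s =
  (PROX f1 (s.1.1 - gradF0 f0 s.1.1 - B *m s.2 - B *m s.1.1 + gamma *: s.1.2)
     - s.1.1,
   PROX f2 (s.1.1 - gamma *: s.1.2) - s.1.1,
   B *m s.1.1).
Proof.
case: s => [[x z] v] /=; rewrite -!scalemxAl -!(stack_coupling graph_eA).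
congr (_, _, _); apply: eq_blocks => i.
- rewrite block_stack blockB block_PROX blockD !blockB !blockZ.
  by rewrite block_stack block_stack block_stack.
- by rewrite block_stack blockB block_PROX blockB blockZ.
- by rewrite block_stack blockZ block_stack.
Qed.

Lemma equilibriumE s : equilibrium F s -> [/\ B *m s.1.1 = 0,
  PROX f1 (s.1.1 - gradF0 f0 s.1.1 - B *m s.2 - B *m s.1.1 + gamma *: s.1.2)
    = s.1.1 & PROX f2 (s.1.1 - gamma *: s.1.2) = s.1.1].
Proof.
by rewrite /equilibrium algorithmE => -[] /subr0_eq -> /subr0_eq -> ->.
Qed.

Let cx := @state_fst_continuous R n q.
Let cz := @state_snd_continuous R n q.
Let cv := @state_thd_continuous R n q.
Let cBx : continuous (fun s : S => B *m s.1.1).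
Proof. exact: (continuousT_comp cx (@continuous_mulmx _ _ _ _ B)). Qed.
Let cBv : continuous (fun s : S => B *m s.2).
Proof. exact: (continuousT_comp cv (@continuous_mulmx _ _ _ _ B)). Qed.

Lemma algorithm_continuous : continuous F.
Proof.
have cG : continuous (gradF0 f0).
  apply: gradF0_continuous => i x; apply: differentiable_continuous.
  by case: (f0_C2 i).
have c1 : continuous (fun s : S => PROX f1
    (s.1.1 - gradF0 f0 s.1.1 - B *m s.2 - B *m s.1.1 + gamma *: s.1.2) - s.1.1).
  apply: continuous_addv; last exact: continuous_oppv.
  apply: (continuousT_comp _ (PROX_continuous f1_cvx)).
  apply: continuous_addv; last exact: continuous_scalev.
  do 2 (apply: continuous_addv; last exact: continuous_oppv).
  by apply: continuous_addv => //; apply: continuous_oppv; exact: continuousT_comp.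
have c2 : continuous (fun s : S => PROX f2 (s.1.1 - gamma *: s.1.2) - s.1.1).
  apply: continuous_addv; last exact: continuous_oppv.
  apply: (continuousT_comp _ (PROX_continuous f2_cvx)).
  by apply: continuous_addv => //; apply: continuous_oppv; exact: continuous_scalev.
have -> : F = fun s => (PROX f1 (s.1.1 - gradF0 f0 s.1.1 - B *m s.2
    - B *m s.1.1 + gamma *: s.1.2) - s.1.1,
    PROX f2 (s.1.1 - gamma *: s.1.2) - s.1.1, B *m s.1.1).
  by apply/funext => s; exact: algorithmE.
exact: continuous_pair (continuous_pair c1 c2) cBx.
Qed.

Section Equilibrium.
Variable star : S.
Hypothesis star_eq : equilibrium F star.
Local Notation xs := star.1.1.
Local Notation zs := star.1.2.
Local Notation vs := star.2.
Local Notation V := (lyapunov_V A f0 alpha gamma star).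

Lemma lyapunov_VE s : V s =
  2^-1 * dotp (s.1.1 - xs) (s.1.1 - xs)
  + 2^-1 * gamma * dotp (s.1.2 - zs) (s.1.2 - zs)
  - gamma * dotp (s.1.1 - xs) (s.1.2 - zs) + 2^-1 * dotp (s.2 - vs) (s.2 - vs)
  + (\sum_i f0 i (block s.1.1 i) - \sum_i f0 i (block xs i)
     - dotp (gradF0 f0 xs) (s.1.1 - xs) + 2^-1 * dotp s.1.1 (B *m s.1.1))
  + dotp s.1.1 (B *m (s.2 - vs)).
Proof.
case: s star => [[x z] v] [[xs zs] vs]; rewrite /lyapunov_V /V1 /V2 /V3 /=.
rewrite !enorm_sqr -!scalemxAl !dotpZr mulrA (dotpC (x - xs) (gradF0 _ _)).
congr (_ + (_ - _ + _) + _).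
rewrite dotpE -sumrB; apply: eq_bigr => i _.
by rewrite !mxE mul1r.
Qed.

Lemma lyapunov_V_star : V star = 0.
Proof.
have [Bxs _ _] := equilibriumE star_eq.
by rewrite lyapunov_VE !subrr Bxs mulmx0 !dotp0r !mulr0 !(addr0, subr0).
Qed.

Let dotpB x : dotp x (B *m x) = dotp (x - xs) (B *m (x - xs)).
Proof.
have [Bxs _ _] := equilibriumE star_eq.
rewrite mulmxBr Bxs subr0 dotpDl dotpNl.
by rewrite [dotp xs _](dotp_mul_sym _ _ scaled_laplacian_sym) Bxs dotp0l subr0.
Qed.

(** Half of [|X|^2] comes from V1 and half from strong convexity; one half absorbs the cross term of
    [X] and [Z], which leaves [gamma (1 - gamma) / 2] for [|Z|^2]. The square
    [(X + v).B(X + v) >= 0] trades the terms in [B X] for [- v.Bv / 2], which leaves [gamma / 2] for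
    [|v|^2]. The constant is the least of the three coefficients. *)
Lemma lyapunov_V_lower_bound s : 2^-1 * (gamma * (1 - gamma)) *
  (dotp (s.1.1 - xs) (s.1.1 - xs) + dotp (s.1.2 - zs) (s.1.2 - zs)
   + dotp (s.2 - vs) (s.2 - vs)) <= V s.
Proof.
have [Bxs _ _] := equilibriumE star_eq.
rewrite lyapunov_VE dotpB.
have -> : dotp s.1.1 (B *m (s.2 - vs)) = dotp (s.1.1 - xs) (B *m (s.2 - vs)).
  rewrite dotpDl dotpNl.
  by rewrite [dotp xs _](dotp_mul_sym _ _ scaled_laplacian_sym) Bxs dotp0l subr0.
have H0 := sum_f0_lower_bound f0_diff f0_sc s.1.1 xs.
set X := s.1.1 - xs in H0 *; set Z := s.1.2 - zs; set v := s.2 - vs.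
clearbody X Z v.
have H1 := scaled_laplacian_psd (X + v); rewrite mulmxDr !dotpDl !dotpDr in H1.
rewrite [dotp v (B *m X)](dotp_mul_sym _ _ scaled_laplacian_sym) [dotp _ X]dotpC in H1.
have H2 := scaled_laplacian_le v.
have g1 := gamma_lt1.
(* Young's inequality with parameter [gamma^-1], multiplied by [gamma]: the weight [gamma ^+ 2] on
   [|Z|^2] stays below the available [gamma]. *)
have H3 : 2 * (gamma * dotp X Z) <= dotp X X + gamma ^+ 2 * dotp Z Z.
  have gV : 0 < gamma^-1 by rewrite invr_gt0.
  have := le_trans (ler_norm _) (dotp_young X Z gV).
  rewrite invrK => /(ler_wpM2l (ltW gamma_gt0)).
  rewrite mulrDr mulVKf ?gt_eqF//; lra.
have X0 := dotp_ge0 X; have v0 := dotp_ge0 v.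
have K1 : gamma * (1 - gamma) <= gamma by have := sqr_ge0 gamma; lra.
have H4 : gamma * (1 - gamma) * dotp X X <= dotp X X by rewrite ler_piMl//; lra.
have H5 : gamma * (1 - gamma) * dotp v v <= gamma * dotp v v by rewrite ler_wpM2r.
lra.
Qed.

(* The monotonicity of the two proximal maps between the state and the
   equilibrium turns the derivative of [V] into the negative of a quadratic
   form in [(x - xs, dx, dz)]. *)
Definition dissipation s : R := dotp (F s).1.1 (F s).1.1
  + 2^-1 * (1 - gamma) * (dotp (F s).1.2 (F s).1.2 + dotp (s.1.1 - xs) (s.1.1 - xs)).

(** The differential of [V] at [s] in the direction [ds]; detached from time, its estimate is purely
    algebraic. *)
Definition lyapunov_V_derivative s (ds : S) : R :=
  dotp (s.1.1 - xs) ds.1.1 + gamma * dotp (s.1.2 - zs) ds.1.2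
  - gamma * (dotp ds.1.1 (s.1.2 - zs) + dotp (s.1.1 - xs) ds.1.2)
  + dotp (s.2 - vs) ds.2
  + (dotp (gradF0 f0 s.1.1) ds.1.1 - dotp (gradF0 f0 xs) ds.1.1
     + dotp (B *m s.1.1) ds.1.1)
  + (dotp ds.1.1 (B *m (s.2 - vs)) + dotp s.1.1 (B *m ds.2)).

Lemma is_derive_lyapunov_V X (t : R) : trajectory F X -> 0 < t ->
  is_derive t 1 (V \o X) (lyapunov_V_derivative (X t) (F (X t))).
Proof.
move=> XF t0.
have dx : is_derive t 1 (fun t => (X t).1.1) (F (X t)).1.1.
  exact: (trajectory_is_derive (p := fun s : S => s.1.1) XF).
have dz : is_derive t 1 (fun t => (X t).1.2) (F (X t)).1.2.
  exact: (trajectory_is_derive (p := fun s : S => s.1.2) XF).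
have dv : is_derive t 1 (fun t => (X t).2) (F (X t)).2.
  exact: (trajectory_is_derive (p := fun s : S => s.2) XF).
have sub (y : R -> vec) dy c : is_derive t 1 y dy ->
    is_derive t 1 (fun t => y t - c) dy.
  by move=> Hy; apply: (is_derive_eq (is_derive_subv Hy (is_derive_cstr c t)));
    rewrite subr0.
have scal (h : R -> R) dh c : is_derive t 1 h dh ->
    is_derive t 1 (fun t => c * h t) (c * dh).
  move=> Hh; apply: (is_derive_eq (is_derive_mulr (is_derive_cstr c t) Hh)).
  by rewrite mul0r add0r.
have dX := sub _ _ xs dx; have dZ := sub _ _ zs dz; have dVv := sub _ _ vs dv.
have -> : V \o X = fun t => 
  2^-1 * dotp ((X t).1.1 - xs) ((X t).1.1 - xs)
  + 2^-1 * gamma * dotp ((X t).1.2 - zs) ((X t).1.2 - zs)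
  - gamma * dotp ((X t).1.1 - xs) ((X t).1.2 - zs)
  + 2^-1 * dotp ((X t).2 - vs) ((X t).2 - vs)
  + (\sum_i f0 i (block (X t).1.1 i) - \sum_i f0 i (block xs i)
     - dotp (gradF0 f0 xs) ((X t).1.1 - xs)
     + 2^-1 * dotp (X t).1.1 (B *m (X t).1.1))
  + dotp (X t).1.1 (B *m ((X t).2 - vs)).
  by apply/funext => u; exact: lyapunov_VE.
apply: (is_derive_eq
  (is_derive_addr
    (is_derive_addr
      (is_derive_addr
        (is_derive_subr
          (is_derive_addr (scal _ _ 2^-1 (is_derive_dotp dX dX))
            (scal _ _ (2^-1 * gamma) (is_derive_dotp dZ dZ)))
          (scal _ _ gamma (is_derive_dotp dX dZ)))
        (scal _ _ 2^-1 (is_derive_dotp dVv dVv)))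
      (is_derive_addr
        (is_derive_subr
          (is_derive_subr (is_derive_sum_f0 f0_diff dx)
            (is_derive_cstr (\sum_i f0 i (block xs i)) t))
          (is_derive_dotp (is_derive_cstr (gradF0 f0 xs) t) dX))
        (scal _ _ 2^-1 (is_derive_dotp dx (is_derive_mulmx B dx)))))
    (is_derive_dotp dx (is_derive_mulmx B dVv)))).
rewrite /lyapunov_V_derivative; cbv beta; move: (X t) => s; move: (F s) => ds.
rewrite dotp0l (dotpC ds.1.1 (B *m s.1.1)) !(dotp_mul_sym s.1.1 _ scaled_laplacian_sym).
rewrite (dotpC ds.1.1 (s.1.1 - xs)) (dotpC ds.1.2) (dotpC ds.2).
by field.
Qed.

Lemma lyapunov_V_derivative_le s :
  lyapunov_V_derivative s (F s) <= - dissipation s.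
Proof.
have [Bxs P1 P2] := equilibriumE star_eq.
have M1 := PROX_monotone f1_cvx
  (s.1.1 - gradF0 f0 s.1.1 - B *m s.2 - B *m s.1.1 + gamma *: s.1.2)
  (xs - gradF0 f0 xs - B *m vs - B *m xs + gamma *: zs).
have M2 := PROX_monotone f2_cvx (s.1.1 - gamma *: s.1.2) (xs - gamma *: zs).
rewrite P1 in M1; rewrite P2 in M2.
have M3 := gradF0_monotone f0_sc s.1.1 xs.
(* This is [B^2 <= B], a consequence of [0 <= B <= I]; it offsets the [|B x|^2] coming from V3. *)
have M4 : dotp (B *m s.1.1) (B *m s.1.1) <= dotp (s.1.1 - xs) (B *m (s.1.1 - xs)).
  have g2 : 1 - gamma <= 1 by rewrite gerBl ltW.
  apply: (le_trans (sqr_form_le _ scaled_laplacian_sym scaled_laplacian_psd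
    scaled_laplacian_le g2)).
  by rewrite (dotpB s.1.1).
rewrite mulmxBr Bxs subr0 in M4.
have Bvu : dotp (s.2 - vs) (B *m s.1.1) = dotp (s.1.1 - xs) (B *m (s.2 - vs)).
  rewrite dotpC -(dotp_mul_sym _ _ scaled_laplacian_sym) [in RHS]dotpDl dotpNl.
  by rewrite [dotp xs _](dotp_mul_sym _ _ scaled_laplacian_sym) Bxs dotp0l subr0.
rewrite /lyapunov_V_derivative /dissipation algorithmE /= Bvu.
rewrite [dotp s.1.1 _](dotp_mul_sym _ _ scaled_laplacian_sym) mulmxBr.
move: M1 M2 M3 M4; rewrite Bxs.
(* From here on all these are opaque vectors, and the claim is an instance of [dissipation_vectors]
   with [X = x - x0], [dx = p1 - x] and [dz = p2 - x], so that [X + dx = p1 - x0] and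
   [X + dz = p2 - x0]. *)
move: (PROX f1 _) (PROX f2 _) => p1 p2.
move: (B *m s.1.1) (B *m s.2) (B *m vs) => u bv bvs.
move: (gradF0 f0 s.1.1) (gradF0 f0 xs) => gx gs; move: s.1.1 s.1.2 xs zs.
move=> x z x0 z0 M1 M2 M3 M4; rewrite -dotpNl -dotpDl.
apply: (dissipation_vectors gamma_gt0 gamma_lt1) => //.
- have -> : x - x0 + (p1 - x) = p1 - x0 by rewrite addrC subrKA.
  move: M1; congr (0 <= dotp _ _); apply/colP => k; rewrite !mxE; ring.
- have -> : x - x0 + (p2 - x) = p2 - x0 by rewrite addrC subrKA.
  move: M2; congr (0 <= dotp _ _); apply/colP => k; rewrite !mxE; ring.
Qed.
Lemma lyapunov_V_continuous : continuous V.
Proof.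
have cX c : continuous (fun s : S => s.1.1 - c).
  by apply: continuous_addv => //; exact: continuous_cst.
have cZ c : continuous (fun s : S => s.1.2 - c).
  by apply: continuous_addv => //; exact: continuous_cst.
have cV c : continuous (fun s : S => s.2 - c).
  by apply: continuous_addv => //; exact: continuous_cst.
have cBV : continuous (fun s : S => B *m (s.2 - vs)).
  exact: (continuousT_comp (cV vs) (@continuous_mulmx _ _ _ _ B)).
have cf : continuous (fun s : S => \sum_i f0 i (block s.1.1 i)).
  exact: (continuousT_comp cx (sum_f0_continuous f0_diff)).
have d1 := continuous_dotp (cX xs) (cX xs).
have d2 := continuous_dotp (cZ zs) (cZ zs).
have d3 := continuous_dotp (cX xs) (cZ zs).
have d4 := continuous_dotp (cV vs) (cV vs).
have d5 := continuous_dotp (@continuous_cst S _ (gradF0 f0 xs)) (cX xs).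
have d6 := continuous_dotp cx cBx.
have d7 := continuous_dotp cx cBV.
have -> : V = fun s => 2^-1 * dotp (s.1.1 - xs) (s.1.1 - xs)
    + 2^-1 * gamma * dotp (s.1.2 - zs) (s.1.2 - zs)
    - gamma * dotp (s.1.1 - xs) (s.1.2 - zs) + 2^-1 * dotp (s.2 - vs) (s.2 - vs)
    + (\sum_i f0 i (block s.1.1 i) - \sum_i f0 i (block xs i)
       - dotp (gradF0 f0 xs) (s.1.1 - xs) + 2^-1 * dotp s.1.1 (B *m s.1.1))
    + dotp s.1.1 (B *m (s.2 - vs)) by apply/funext => s; exact: lyapunov_VE.
apply: (continuous_addv (V := R)); last exact: d7.
apply: (continuous_addv (V := R)).
  apply: (continuous_addv (V := R)); last exact: continuousMl.
  apply: (continuous_addv (V := R)); last first.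
    by apply: (continuous_oppv (V := R)); exact: continuousMl.
  by apply: (continuous_addv (V := R)); exact: continuousMl.
apply: (continuous_addv (V := R)); last exact: continuousMl.
apply: (continuous_addv (V := R)); last exact: (continuous_oppv (V := R)).
by apply: (continuous_addv (V := R)) => //; exact: continuous_cst.
Qed.

Lemma dissipation_continuous : continuous dissipation.
Proof.
have cF := algorithm_continuous.
have c1 : continuous (fun s => (F s).1.1) := continuousT_comp cF cx.
have c2 : continuous (fun s => (F s).1.2) := continuousT_comp cF cz.
have c3 : continuous (fun s : S => s.1.1 - xs).
  by apply: continuous_addv => //; exact: continuous_cst.
apply: (continuous_addv (V := R)); first exact: continuous_dotp.
apply: continuousMl; apply: (continuous_addv (V := R)); exact: continuous_dotp.
Qed.

Lemma dissipation_ge0 s : 0 <= dissipation s.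
Proof.
have g1 : 0 <= 1 - gamma by rewrite subr_ge0 ltW// gamma_lt1.
by rewrite addr_ge0 ?dotp_ge0// !mulr_ge0 ?invr_ge0// addr_ge0 ?dotp_ge0.
Qed.

(** The term in [x - xs] controls the third velocity, which does not occur in [dissipation]: if
    [x = xs], it equals [B xs = 0]. *)
Lemma dissipation_eq0 s : dissipation s = 0 -> F s = 0.
Proof.
have g1 : 0 < 2^-1 * (1 - gamma) by rewrite mulr_gt0 ?invr_gt0// subr_gt0 gamma_lt1.
have [Bxs _ _] := equilibriumE star_eq.
rewrite /dissipation => /eqP; rewrite paddr_eq0 ?dotp_ge0//; last first.
  by rewrite mulr_ge0 ?(ltW g1)// addr_ge0 ?dotp_ge0.
rewrite mulf_eq0 (gt_eqF g1)/= paddr_eq0 ?dotp_ge0// => /and3P[/eqP/dotp_eq0 E1].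
move=> /eqP/dotp_eq0 E2 /eqP/dotp_eq0/subr0_eq E3.
have E4 : (F s).2 = 0 by rewrite algorithmE /= E3.
by case: (F s) E1 E2 E4 => [[a b] c] /= -> -> ->.
Qed.

Lemma lyapunov_V_coercive s :
  2^-1 * (gamma * (1 - gamma)) * `|s - star| ^+ 2 <= V s.
Proof.
apply: le_trans (lyapunov_V_lower_bound s); rewrite ler_wpM2l//.
  by rewrite !mulr_ge0 ?invr_ge0 ?(ltW gamma_gt0)// subr_ge0 ltW// gamma_lt1.
exact: sqr_state_norm_le.
Qed.

Lemma coercivity_gt0 : 0 < 2^-1 * (gamma * (1 - gamma)).
Proof. by rewrite !mulr_gt0 ?invr_gt0// subr_gt0 gamma_lt1. Qed.

Lemma lyapunov_V_pair : lyapunov_pair F star V dissipation.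
Proof.
split.
- by split; [exact: lyapunov_V_continuous|exact: lyapunov_V_star].
- exists (2^-1 * (gamma * (1 - gamma))); first exact: coercivity_gt0.
  exact: lyapunov_V_coercive.
- exact: dissipation_continuous.
- by move=> y; split; [exact: dissipation_ge0|exact: dissipation_eq0].
- move=> X t XF t0; eexists; first exact: is_derive_lyapunov_V.
  exact: lyapunov_V_derivative_le.
Qed.

(* Summing the two subgradient inclusions with the gradient of the smooth part
   leaves [- B vs], which is orthogonal to the kernel of the Laplacian. *)
Lemma equilibrium_solution : solution A f0 f1 f2 xs.
Proof.
have [Bxs P1 P2] := equilibriumE star_eq.
set xi1 : vec := _ + gamma *: zs in P1; set xi2 := _ - gamma *: zs in P2.
have B0 y : laplacian_nq q A *m y = 0 -> B *m y = 0.
  by move=> Ly; rewrite -scalemxAl Ly scaler0.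
have S1 i : subgradient (f1 i) (block xs i) (block (xi1 - xs) i).
  have := prox_subgradient (f1_cvx i) (block xi1 i).
  by rewrite -block_PROX P1 -blockB.
have S2 i : subgradient (f2 i) (block xs i) (block (xi2 - xs) i).
  have := prox_subgradient (f2_cvx i) (block xi2 i).
  by rewrite -block_PROX P2 -blockB.
pose c i := f0 i (block xs i) + fine (f1 i (block xs i)) + fine (f2 i (block xs i)).
have objE : objective f0 f1 f2 xs = (\sum_i c i)%:E.
  rewrite /objective -sumEFin; apply: eq_bigr => i _.
  have [F1 _] := S1 i; have [F2 _] := S2 i.
  by rewrite /c !EFinD !fineK.
split.
- move: Bxs; rewrite -scalemxAl => /eqP; rewrite scaler_eq0 gt_eqF//=.
  by move=> /eqP.
- by rewrite objE.
move=> y Ly; rewrite objE.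
pose d := y - xs.
pose r i := dotp (gradient (f0 i) (block xs i)) (block d i)
  + dotp (block (xi1 - xs) i) (block d i) + dotp (block (xi2 - xs) i) (block d i).
have sumr : \sum_i r i = 0.
  rewrite /r !big_split/= -dotp_gradF0 -!dotp_blocks -!dotpDl.
  have -> : gradF0 f0 xs + (xi1 - xs) + (xi2 - xs) = - (B *m vs) - B *m xs.
    rewrite /xi1 /xi2; move: (gradF0 f0 xs) (B *m vs) (B *m xs) => g b b'.
    by apply/colP => k; rewrite !mxE; ring.
  rewrite Bxs subr0 dotpNl -(dotp_mul_sym _ _ scaled_laplacian_sym).
  rewrite mulmxBr Bxs B0// subr0.
  by rewrite dotp0r oppr0.
(* Only the sum of the [r i] vanishes, since a single node need not be at its own optimum; they are
   inserted before the comparison node by node. *)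
have -> : \sum_i c i = \sum_i (c i + r i).
  by rewrite [RHS]big_split [RHS]/= sumr addr0.
rewrite -sumEFin; apply: lee_sum => i _.
have [F1 H1] := S1 i; have [F2 H2] := S2 i.
have H0 : f0 i (block xs i) + dotp (gradient (f0 i) (block xs i)) (block d i)
    <= f0 i (block y i).
  rewrite /d blockB.
  have := strongly_convex_lower_bound (block y i) (block xs i) (f0_diff i) (f0_sc i).
  by apply: le_trans; rewrite lerDl mulr1 mulr_ge0 ?dotp_ge0.
have H0' : ((f0 i (block xs i)
      + dotp (gradient (f0 i) (block xs i)) (block d i))%:E <=
      (f0 i (block y i))%:E)%E by rewrite lee_fin.
have := leeD (leeD H0' (H1 (block y i))) (H2 (block y i)).
rewrite -blockB -/d; apply: le_trans.
rewrite -(fineK F1) -(fineK F2) -!EFinD lee_fin /c /r.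
rewrite le_eqVlt; apply/orP; left; apply/eqP; ring.
Qed.

End Equilibrium.
End Algorithm.

Theorem theorem5p1 (R : realType) (n q : nat) (e : rel 'I_n) (A : 'M[R]_n)
    (f0 : 'I_n -> 'cV[R]_q -> R) (f1 f2 : 'I_n -> 'cV[R]_q -> \bar R)
    (alpha gamma : R) (star : state R n q)
    (graph_eA : weighted_graph e A)
    (f0_C2 : forall i, twice_continuously_differentiable (f0 i))
    (f0_sc : exists2 c : R, 1 < c & forall i, strongly_convex c (f0 i))
    (f1_cvx : forall i, lsc_closed_proper_convex (f1 i))
    (f2_cvx : forall i, lsc_closed_proper_convex (f2 i))
    (e_conn : connected_graph e)
    (P_solvable : exists x : 'cV[R]_(n * q), solution A f0 f1 f2 x)
    (alpha_gt0 : 0 < alpha)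
    (* inverse in \bar R, where 0^-1 = +oo: no upper bound if lambda_max is 0 *)
    (alpha_lt : (alpha%:E < ((lambda_max (laplacian A))%:E)^-1)%E)
    (gamma_gt0 : 0 < gamma)
    (gamma_lt : gamma < 1 - alpha * lambda_max (laplacian A))
    (star_eq : equilibrium (algorithm e A f0 f1 f2 alpha gamma) star) :
  let F := algorithm e A f0 f1 f2 alpha gamma in
  let V := lyapunov_V A f0 alpha gamma star in
  [/\ positive_definite_at V star, radially_unbounded V &
      forall s : state R n q, V s = 0 <-> s = star]
  /\ ((forall s : state R n q, equilibrium F s -> lyapunov_stable F s)
      /\ (forall X : R -> state R n q, trajectory F X ->
            [bounded X t | t in [set t | 0 <= t]]))
  /\ (forall X : R -> state R n q, trajectory F X ->
        cvg (X t @[t --> +oo])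
        /\ solution A f0 f1 f2 (lim ((X t).1.1 @[t --> +oo]))).
Proof.
move=> F V.
(* The estimates use [|x - xs|^2] with unit coefficient, so the modulus is lowered from [c > 1] to
   1. *)
have f0_sc1 i : strongly_convex 1 (f0 i).
  case: f0_sc => c c1 sc a b ab; apply: le_trans (sc i a b ab).
  by rewrite ler_wpM2r ?sqr_ge0// ltW.
have pair s : equilibrium F s ->
    lyapunov_pair F s (lyapunov_V A f0 alpha gamma s)
      (dissipation e A f0 f1 f2 alpha gamma s).
  by move=> Fs; exact: lyapunov_V_pair.
have [[_ V0] _ _ _ _] := pair _ star_eq.
have Vlow s : 2^-1 * (gamma * (1 - gamma)) * `|s - star| ^+ 2 <= V s.
  by apply: lyapunov_V_coercive star_eq _.
have k0 : 0 < 2^-1 * (gamma * (1 - gamma)).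
  exact: coercivity_gt0 graph_eA alpha_gt0 gamma_gt0 gamma_lt.
set k := 2^-1 * _ in Vlow k0.
have Vpos s : s <> star -> 0 < V s.
  move=> ss; apply: lt_le_trans (Vlow s).
  by rewrite mulr_gt0// exprn_gt0// normr_gt0 subr_eq0; exact/eqP.
have cvgX X : trajectory F X ->
    exists2 y, F y = 0 & X t @[t --> +oo] --> y.
  move=> XF; apply: (trajectory_cvg _ _ _ (pair _ star_eq)) => //.
  - exact: algorithm_continuous.
  - exact: state_compact_ball.
  - by move=> Y a b M; exact: state_trajectory_speed.
  - by move=> y Fy; do 2 eexists; exact: pair.
split; [split|split; [split|]].
- by split.
(* At distance [sqrt (|M| / k)] from [star] the coercive bound equals [|M|]; the summand [|star|]
   recentres the radius at the origin. *)
- move=> M; exists (`|star| + Num.sqrt (`|M| / k) ) => s sr.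
  apply: lt_le_trans (Vlow s).
  have H : Num.sqrt (`|M| / k) < `|s - star|.
    rewrite -(ltrD2l `|star|); apply: lt_le_trans sr _.
    by rewrite -{1}(subrK star s) addrC ler_normD.
  apply: le_lt_trans (ler_norm M) _.
  rewrite mulrC -ltr_pdivrMr// -[ltLHS]sqr_sqrtr ?divr_ge0// ?(ltW k0)//.
  by rewrite ltr_pXn2r// ?nnegrE ?sqrtr_ge0.
- move=> s; split=> [Vs|->//]; apply: contrapT => /Vpos.
  by rewrite Vs ltxx.
- move=> s Fs eps eps0.
  have [d d0 Hd] := lyapunov_pair_stable (pair s Fs) eps0.
  by exists d => // X XF X0 t t0; exact: (Hd X 0 t).
- move=> X XF; have [a Xa] := lyapunov_pair_bounded (pair _ star_eq) XF.
  exists (a + `|star|); split; first exact: num_real.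
  move=> M aM t t0; apply: le_trans (ltW aM).
  by rewrite -(subrK star (X t)) (le_trans (ler_normD _ _))// lerD2r Xa.
- move=> X XF; have [y Fy Xy] := cvgX X XF; split.
    by apply/cvg_ex; exists y.
  have -> : lim ((X t).1.1 @[t --> +oo]) = y.1.1.
    apply: cvg_lim; first exact: norm_hausdorff.
    exact: (cvg_comp _ _ Xy (@state_fst_continuous _ _ _ y)).
  exact: equilibrium_solution Fy.
Qed.
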